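(* Let $a_1,a_2$ be integers with $0<a_1\leq a_2-2$ and $a_2\geq 3$, and put $a_1':=\max\{4(a_2-a_1),4a_1\}$. Let $N$ be a positive multiple of $a_1a_2$ with $N\geq 396.59\,a_1'a_2^2(a_2-a_1)^2$. Put $\theta_1=\sqrt{1+\frac{4a_2}{N}}$ and $\theta_2=\sqrt{1+\frac{4a_1}{N}}$. Then $$\lambda:=1+\frac{\log(2.500788\,a_1^{-1}a_1'a_2N)}{\log(0.04216\,a_1^{-1}a_2^{-1}(a_2-a_1)^{-2}N^2)}<2,$$ and for all integers $p_1,p_2,q$ with $q>0$, $$\max\left\{\left|\theta_1-\frac{p_1}{q}\right|,\left|\theta_2-\frac{p_2}{q}\right|\right\}>\frac{a_1}{3.53081\cdot 10^{27}\,a_1'a_2N}\,q^{-\lambda}.$$ *)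

(* Defs.v *)
From Stdlib Require Import Reals ZArith.
Open Scope R_scope.

Definition a1prime (a1 a2 : Z) : Z := Z.max (4 * (a2 - a1)) (4 * a1).

Definition lam (a1 a2 N : Z) : R :=
  1 + ln (2500788 / 1000000 * / IZR a1 * IZR (a1prime a1 a2) * IZR a2 * IZR N)
      / ln (4216 / 100000 * / IZR a1 * / IZR a2 * / (IZR (a2 - a1)) ^ 2 * (IZR N) ^ 2).

(* Main.v *)
(** Rickert's simultaneous Padé forms, as formal residue sums instead of contour integrals.
    Put x = 4/N, let the nodes be 0, a1, a2 and let A = z (z - a1) (z - a2).  For each node a_i,
    the sum of the residues of (1 + x z)^(k + 1/2) / ((z - a_i) A^k) is
    p_0 + p_1 sqrt (1 + a1 x) + p_2 sqrt (1 + a2 x) with p_j rational.  Expanding the numerator in powers of z, the residue sums of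
    z^n / ((z - a_i) A^k) vanish for n < 3k, so the form is of size about (4/27)^k x^(3k).

    Since 4^n binom(1/2, n) is an integer and a1 a2 divides N, the factor
    (N a1 a2 (a2 - a1)^2)^k clears all denominators.  This absorbs the powers of 2 into x, and
    the resulting growth rates are good enough for the stated exponent without extracting any
    further common factor of the coefficients.

    The three forms (i = 0, 1, 2) do not vanish simultaneously at a rational point with nonzero
    first coordinate: otherwise, as the residues of a derivative vanish, the equation
    (1 + x z) g' = (k + 1/2) x g would force by recurrence on n the vanishing of all weighted
    residue sums of z^n g / A^(k+1); the leading factor n - 2k + 3/2 of the recurrence is never
    zero. *)

Require Import Defs.
From Stdlib Require Import Reals ZArith Lra Lia FunctionalExtensionality.
From Coquelicot Require Import Coquelicot.
Open Scope R_scope.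

(** * Formal power series *)

Definition ser : Type := nat -> R.
Definition sadd (a b : ser) : ser := fun n => a n + b n.
Definition sopp (a : ser) : ser := fun n => - a n.
Definition ssub (a b : ser) : ser := fun n => a n - b n.
Definition smul (a b : ser) : ser :=
  fun n => sum_f_R0 (fun i => a i * b (n - i)%nat) n.
Definition scst (c : R) : ser := fun n => match n with O => c | S _ => 0 end.
Definition svar : ser := fun n => match n with 1%nat => 1 | _ => 0 end.
Definition stl (a : ser) : ser := fun n => a (S n).
(* The Euler operator t d/dt. *)
Definition seuler (a : ser) : ser := fun n => INR n * a n.
Fixpoint spow (a : ser) (n : nat) : ser :=
  match n with O => scst 1 | S n => smul a (spow a n) end.

Declare Scope ser_scope.
Delimit Scope ser_scope with ser.
Bind Scope ser_scope with ser.
Infix "+" := sadd : ser_scope.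
Infix "*" := smul : ser_scope.
Infix "-" := ssub : ser_scope.
Infix "^" := spow : ser_scope.

Lemma smul_0 a b : smul a b 0%nat = a 0%nat * b 0%nat.
Proof. reflexivity. Qed.

Lemma smul_S a b n : smul a b (S n) = a 0%nat * b (S n) + smul (stl a) b n.
Proof. unfold smul. rewrite decomp_sum by lia. reflexivity. Qed.

Lemma smul_S' a b n : smul a b (S n) = smul a (stl b) n + a (S n) * b 0%nat.
Proof.
  unfold smul. rewrite tech5, Nat.sub_diag. f_equal.
  apply sum_eq. intros i Hi. unfold stl. now rewrite Nat.sub_succ_l by lia.
Qed.

Lemma smul_add_l a b c : ((a + b) * c = a * c + b * c)%ser.
Proof.
  apply functional_extensionality; intro n. unfold smul, sadd.
  rewrite <- sum_plus. apply sum_eq. intros; ring.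
Qed.

Lemma smul_scal c a b n : smul (fun i => c * a i) b n = c * smul a b n.
Proof.
  unfold smul. rewrite scal_sum. apply sum_eq. intros; ring.
Qed.

Lemma smul_comm a b : (a * b = b * a)%ser.
Proof.
  apply functional_extensionality; intro n. revert a b.
  induction n as [|n IH]; intros a b.
  - rewrite !smul_0. ring.
  - rewrite smul_S, smul_S', IH. ring.
Qed.

Lemma smul_assoc a b c : (a * (b * c) = (a * b) * c)%ser.
Proof.
  apply functional_extensionality; intro n. revert a b c.
  induction n as [|n IH]; intros a b c.
  - rewrite !smul_0. ring.
  - rewrite (smul_S a), (smul_S (smul a b)), IH.
    replace (stl (smul a b)) with (sadd (fun i => a 0%nat * stl b i) (smul (stl a) b))
      by (apply functional_extensionality; intro i; unfold sadd, stl at 3;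
          now rewrite smul_S).
    rewrite smul_add_l. unfold sadd at 1. rewrite smul_scal, smul_0, smul_S. ring.
Qed.

Lemma smul_scst c a n : smul (scst c) a n = c * a n.
Proof.
  destruct n; [reflexivity|]. rewrite smul_S. simpl.
  assert (E : smul (stl (scst c)) a n = 0).
  { unfold smul. rewrite <- (Rmult_0_l (sum_f_R0 a n)), scal_sum. apply sum_eq.
    intros; unfold stl, scst; ring. }
  rewrite E. ring.
Qed.

(** Equality of series is Leibniz equality, by functional extensionality, so [ring] and [rewrite]
    act on series directly. *)
Lemma ser_ring_theory :
  ring_theory (scst 0) (scst 1) sadd smul ssub sopp (@eq ser).
Proof.
  constructor; intros;
    try (apply functional_extensionality; intro n;
         unfold sadd, ssub, sopp; try rewrite smul_scst; try destruct n; simpl; ring).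
  - apply smul_comm.
  - apply smul_assoc.
  - apply smul_add_l.
Qed.

Add Ring ser_ring : ser_ring_theory.

Lemma scst_add c d : scst (c + d) = (scst c + scst d)%ser.
Proof. apply functional_extensionality; intros [|n]; unfold sadd; simpl; ring. Qed.

Lemma scst_sub c d : scst (c - d) = (scst c - scst d)%ser.
Proof. apply functional_extensionality; intros [|n]; unfold ssub; simpl; ring. Qed.

Lemma scst_mul c d : scst (c * d) = (scst c * scst d)%ser.
Proof.
  apply functional_extensionality; intros n; rewrite smul_scst.
  destruct n; simpl; ring.
Qed.

Lemma svar_mul_S a n : smul svar a (S n) = a n.
Proof.
  rewrite smul_S. replace (stl svar) with (scst 1).
  - rewrite smul_scst. simpl. ring.
  - apply functional_extensionality; intros [|i]; reflexivity.
Qed.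

Lemma spow_smul a b n : ((a * b) ^ n = a ^ n * b ^ n)%ser.
Proof. induction n as [|n IH]; simpl; [|rewrite IH]; ring. Qed.

Lemma seuler_add a b : seuler (a + b)%ser = (seuler a + seuler b)%ser.
Proof. apply functional_extensionality; intro n; unfold seuler, sadd; ring. Qed.

Lemma seuler_mul a b : seuler (a * b)%ser = (seuler a * b + a * seuler b)%ser.
Proof.
  apply functional_extensionality; intro n. unfold seuler, sadd, smul.
  rewrite scal_sum, <- sum_plus. apply sum_eq. intros i Hi.
  rewrite minus_INR by lia. ring.
Qed.

Lemma seuler_scst c : seuler (scst c) = scst 0.
Proof. apply functional_extensionality; intros [|n]; unfold seuler, scst; simpl; ring. Qed.

Lemma seuler_svar : seuler svar = svar.
Proof. apply functional_extensionality; intros [|[|n]]; unfold seuler, svar; simpl; ring. Qed.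

(** Multiplying through by [a] avoids the exponent n - 1, which would be truncated at n = 0. *)
Lemma seuler_pow a n :
  (a * seuler (a ^ n) = scst (INR n) * seuler a * a ^ n)%ser.
Proof.
  induction n as [|n IH].
  - simpl. rewrite seuler_scst. ring.
  - simpl spow. rewrite seuler_mul, S_INR, scst_add.
    transitivity (a * (a * seuler (a ^ n)) + seuler a * (a * a ^ n))%ser; [ring|].
    rewrite IH. ring.
Qed.

(* The series of 1 / (d + t). *)
Definition sinv (d : R) : ser := fun n => (-1) ^ n / d ^ S n.

Lemma sinv_spec d : d <> 0 -> ((scst d + svar) * sinv d = scst 1)%ser.
Proof.
  intro Hd. rewrite smul_add_l. apply functional_extensionality; intro n.
  unfold sadd. rewrite smul_scst. destruct n as [|n].
  - rewrite smul_0. unfold sinv. simpl. field. assumption.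
  - rewrite svar_mul_S. unfold sinv. simpl. field.
    split; [now apply pow_nonzero|assumption].
Qed.

Lemma seuler_sinv d : d <> 0 ->
  (seuler (sinv d) = scst (-1) * svar * sinv d * sinv d)%ser.
Proof.
  intro Hd.
  assert (E : seuler ((scst d + svar) * sinv d)%ser = scst 0)
    by (rewrite sinv_spec by assumption; apply seuler_scst).
  rewrite seuler_mul, seuler_add, seuler_scst, seuler_svar in E.
  assert (M1 : (scst 0 - scst 1)%ser = scst (-1))
    by (rewrite <- scst_sub; f_equal; ring).
  transitivity (((scst d + svar) * sinv d) * seuler (sinv d))%ser.
  { rewrite sinv_spec by assumption. ring. }
  transitivity (sinv d * (((scst 0 + svar) * sinv d + (scst d + svar) * seuler (sinv d))
     - svar * sinv d))%ser; [ring|].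
  rewrite E, <- M1. ring.
Qed.

Lemma seuler_sinv_pow d n : d <> 0 ->
  (seuler (sinv d ^ n) = scst (- INR n) * svar * sinv d ^ S n)%ser.
Proof.
  intro Hd. induction n as [|n IH].
  - simpl. rewrite seuler_scst, Ropp_0. ring.
  - simpl spow in *. rewrite seuler_mul, IH, seuler_sinv by assumption.
    replace (- INR (S n)) with (- INR n + -1) by (rewrite S_INR; ring).
    rewrite scst_add. ring.
Qed.

(** * Sums of residues at the nodes 0, a1, a2 *)

(* The residue of a / t^m. *)
Definition cfp (m : nat) (a : ser) : R := match m with O => 0 | S m => a m end.

Lemma cfp_add m a b : cfp m (a + b)%ser = cfp m a + cfp m b.
Proof. destruct m; simpl; [ring|reflexivity]. Qed.

Lemma cfp_scal m c a : cfp m (scst c * a)%ser = c * cfp m a.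
Proof. destruct m; simpl; [ring|apply smul_scst]. Qed.

Lemma cfp_svar m a : cfp (S m) (svar * a)%ser = cfp m a.
Proof. destruct m; simpl; [rewrite smul_0; simpl; ring|apply svar_mul_S]. Qed.

(* [f0], [f1], [f2] are expansions in the local parameter t at 0, a1, a2 of the
   numerator of a form with poles of order [m0], [m1], [m2] at these points. *)
Definition res (a1 a2 : R) (m0 m1 m2 : nat) (f0 f1 f2 : ser) : R :=
  cfp m0 (f0 * (sinv (- a1) ^ m1 * sinv (- a2) ^ m2))%ser
  + cfp m1 (f1 * (sinv a1 ^ m0 * sinv (a1 - a2) ^ m2))%ser
  + cfp m2 (f2 * (sinv a2 ^ m0 * sinv (a2 - a1) ^ m1))%ser.

Lemma res_add a1 a2 m0 m1 m2 f0 f1 f2 g0 g1 g2 :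
  res a1 a2 m0 m1 m2 (f0 + g0)%ser (f1 + g1)%ser (f2 + g2)%ser
  = res a1 a2 m0 m1 m2 f0 f1 f2 + res a1 a2 m0 m1 m2 g0 g1 g2.
Proof. unfold res. rewrite !smul_add_l, !cfp_add. ring. Qed.

Lemma res_scal a1 a2 m0 m1 m2 c f0 f1 f2 :
  res a1 a2 m0 m1 m2 (scst c * f0)%ser (scst c * f1)%ser (scst c * f2)%ser
  = c * res a1 a2 m0 m1 m2 f0 f1 f2.
Proof. unfold res. rewrite <- !smul_assoc, !cfp_scal. ring. Qed.

(** In the local parameter t = z - c, the function z - b is [node (c - b)] and, for b distinct from
    c, its inverse is [sinv (c - b)]. In particular z itself is [node a] at the node a. *)
Definition node (a : R) : ser := (scst a + svar)%ser.

Lemma node_0 : node 0 = svar.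
Proof. unfold node. ring. Qed.

Lemma node_cancel d f u n : d <> 0 ->
  (node d * f * (sinv d ^ S n * u) = f * (sinv d ^ n * u))%ser.
Proof.
  intro Hd. unfold node. simpl spow.
  transitivity (((scst d + svar) * sinv d) * (f * (sinv d ^ n * u)))%ser; [ring|].
  rewrite sinv_spec by assumption. ring.
Qed.

Lemma node_cancel_r d f u n : d <> 0 ->
  (node d * f * (u * sinv d ^ S n) = f * (u * sinv d ^ n))%ser.
Proof.
  intro Hd. rewrite (smul_comm u), node_cancel by assumption. ring.
Qed.

Definition nodes_ok (a1 a2 : R) : Prop := 0 < a1 /\ a1 < a2.

Ltac nodes_lra := unfold nodes_ok in *; lra.

(** Multiplying the numerator by z - a_i cancels one factor of the denominator: by a shift of
    coefficients at a_i itself, by [sinv_spec] at the other two nodes. *)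
Lemma res_shift0 a1 a2 m0 m1 m2 f0 f1 f2 : nodes_ok a1 a2 ->
  res a1 a2 (S m0) m1 m2 (svar * f0)%ser (node a1 * f1)%ser (node a2 * f2)%ser
  = res a1 a2 m0 m1 m2 f0 f1 f2.
Proof.
  intro H. unfold res.
  rewrite <- (smul_assoc svar), cfp_svar, !node_cancel by nodes_lra. reflexivity.
Qed.

Lemma res_shift1 a1 a2 m0 m1 m2 f0 f1 f2 : nodes_ok a1 a2 ->
  res a1 a2 m0 (S m1) m2 (node (- a1) * f0)%ser (svar * f1)%ser (node (a2 - a1) * f2)%ser
  = res a1 a2 m0 m1 m2 f0 f1 f2.
Proof.
  intro H. unfold res.
  rewrite <- (smul_assoc svar), cfp_svar, node_cancel, node_cancel_r by nodes_lra.
  reflexivity.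
Qed.

Lemma res_shift2 a1 a2 m0 m1 m2 f0 f1 f2 : nodes_ok a1 a2 ->
  res a1 a2 m0 m1 (S m2) (node (- a2) * f0)%ser (node (a1 - a2) * f1)%ser (svar * f2)%ser
  = res a1 a2 m0 m1 m2 f0 f1 f2.
Proof.
  intro H. unfold res.
  rewrite <- (smul_assoc svar), cfp_svar, !node_cancel_r by nodes_lra.
  reflexivity.
Qed.

(* Multiplication by the global coordinate z = (z - a_l) + a_l. *)
Lemma res_mul_z1 a1 a2 m0 m1 m2 f0 f1 f2 : nodes_ok a1 a2 ->
  res a1 a2 m0 (S m1) m2 (svar * f0)%ser (node a1 * f1)%ser (node a2 * f2)%ser
  = res a1 a2 m0 m1 m2 f0 f1 f2 + a1 * res a1 a2 m0 (S m1) m2 f0 f1 f2.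
Proof.
  intro H. rewrite <- (res_shift1 a1 a2 m0 m1 m2) by assumption.
  rewrite <- res_scal, <- res_add. f_equal; unfold node.
  - replace (- a1) with (0 - a1) by ring. rewrite scst_sub. ring.
  - ring.
  - rewrite scst_sub. ring.
Qed.

Lemma res_mul_z2 a1 a2 m0 m1 m2 f0 f1 f2 : nodes_ok a1 a2 ->
  res a1 a2 m0 m1 (S m2) (svar * f0)%ser (node a1 * f1)%ser (node a2 * f2)%ser
  = res a1 a2 m0 m1 m2 f0 f1 f2 + a2 * res a1 a2 m0 m1 (S m2) f0 f1 f2.
Proof.
  intro H. rewrite <- (res_shift2 a1 a2 m0 m1 m2) by assumption.
  rewrite <- res_scal, <- res_add. f_equal; unfold node.
  - replace (- a2) with (0 - a2) by ring. rewrite scst_sub. ring.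
  - rewrite scst_sub. ring.
  - ring.
Qed.

(* The sum of all residues of z^n / (z^m0 (z - a1)^m1 (z - a2)^m2). *)
Definition hres (a1 a2 : R) (m0 m1 m2 n : nat) : R :=
  res a1 a2 m0 m1 m2 (svar ^ n)%ser (node a1 ^ n)%ser (node a2 ^ n)%ser.

Lemma hres_S0 a1 a2 m0 m1 m2 n : nodes_ok a1 a2 ->
  hres a1 a2 (S m0) m1 m2 (S n) = hres a1 a2 m0 m1 m2 n.
Proof. intro H. unfold hres. simpl spow. now rewrite res_shift0. Qed.

Lemma hres_S1 a1 a2 m0 m1 m2 n : nodes_ok a1 a2 ->
  hres a1 a2 m0 (S m1) m2 (S n) = hres a1 a2 m0 m1 m2 n + a1 * hres a1 a2 m0 (S m1) m2 n.
Proof. intro H. unfold hres. simpl spow. now rewrite res_mul_z1. Qed.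

Lemma hres_S2 a1 a2 m0 m1 m2 n : nodes_ok a1 a2 ->
  hres a1 a2 m0 m1 (S m2) (S n) = hres a1 a2 m0 m1 m2 n + a2 * hres a1 a2 m0 m1 (S m2) n.
Proof. intro H. unfold hres. simpl spow. now rewrite res_mul_z2. Qed.

Lemma cfp_scst1 m : cfp m (scst 1) = if Nat.eqb m 1 then 1 else 0.
Proof. destruct m as [|[|m]]; reflexivity. Qed.

Lemma smul_1_r a : (a * scst 1)%ser = a.
Proof. ring. Qed.

(** The sum is minus the residue at infinity, nonzero only for total order s = 1. Induction on s: if
    two nodes carry poles, their difference times the sum is a difference of two sums of total order
    s - 1, which agree by induction. With a single node the residue is read off directly. *)
Lemma hres_0 a1 a2 m0 m1 m2 : nodes_ok a1 a2 -> (0 < m0 + m1 + m2)%nat ->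
  hres a1 a2 m0 m1 m2 0 = if Nat.eqb (m0 + m1 + m2) 1 then 1 else 0.
Proof.
  intros H. remember (m0 + m1 + m2)%nat as s eqn:Hs. revert m0 m1 m2 Hs.
  induction s as [s IH] using lt_wf_ind; intros m0 m1 m2 Hs Hpos.
  assert (Hstep : forall u v, 0 < v ->
     hres a1 a2 m0 m1 m2 0 * v = u -> u = 0 -> hres a1 a2 m0 m1 m2 0 = 0).
  { intros u v Hv E ->. apply Rmult_integral in E. destruct E; [assumption|lra]. }
  assert (Hsub : (2 <= s)%nat -> forall p0 p1 p2 r0 r1 r2,
     (p0 + p1 + p2 = s - 1)%nat -> (r0 + r1 + r2 = s - 1)%nat ->
     hres a1 a2 p0 p1 p2 0 - hres a1 a2 r0 r1 r2 0 = 0).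
  { intros H2 p0 p1 p2 r0 r1 r2 Hp Hr.
    rewrite (IH (s - 1)%nat) by lia. rewrite (IH (s - 1)%nat) by lia. ring. }
  destruct m0 as [|m0]; destruct m1 as [|m1]; destruct m2 as [|m2];
    try lia; subst s.
  - unfold hres, res. simpl spow. rewrite !smul_1_r, cfp_scst1. simpl.
    rewrite ?Nat.add_0_r. destruct m2; simpl; ring.
  - unfold hres, res. simpl spow. rewrite !smul_1_r, cfp_scst1. simpl.
    rewrite !Nat.add_0_r. destruct m1; simpl; ring.
  - rewrite (proj2 (Nat.eqb_neq _ _)) by lia.
    eapply (Hstep (hres a1 a2 0 m1 (S m2) 0 - hres a1 a2 0 (S m1) m2 0) (a2 - a1));
      [nodes_lra| |apply Hsub; lia].
    pose proof (hres_S1 a1 a2 0 m1 (S m2) 0 H). pose proof (hres_S2 a1 a2 0 (S m1) m2 0 H).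
    lra.
  - unfold hres, res. simpl spow. rewrite !smul_1_r, cfp_scst1. simpl.
    rewrite !Nat.add_0_r. destruct m0; simpl; ring.
  - rewrite (proj2 (Nat.eqb_neq _ _)) by lia.
    eapply (Hstep (hres a1 a2 m0 0 (S m2) 0 - hres a1 a2 (S m0) 0 m2 0) a2);
      [nodes_lra| |apply Hsub; lia].
    pose proof (hres_S0 a1 a2 m0 0 (S m2) 0 H). pose proof (hres_S2 a1 a2 (S m0) 0 m2 0 H).
    lra.
  - rewrite (proj2 (Nat.eqb_neq _ _)) by lia.
    eapply (Hstep (hres a1 a2 m0 (S m1) 0 0 - hres a1 a2 (S m0) m1 0 0) a1);
      [nodes_lra| |apply Hsub; lia].
    pose proof (hres_S0 a1 a2 m0 (S m1) 0 0 H). pose proof (hres_S1 a1 a2 (S m0) m1 0 0 H).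
    lra.
  - rewrite (proj2 (Nat.eqb_neq _ _)) by lia.
    eapply (Hstep (hres a1 a2 m0 (S m1) (S m2) 0 - hres a1 a2 (S m0) m1 (S m2) 0) a1);
      [nodes_lra| |apply Hsub; lia].
    pose proof (hres_S0 a1 a2 m0 (S m1) (S m2) 0 H).
    pose proof (hres_S1 a1 a2 (S m0) m1 (S m2) 0 H).
    lra.
Qed.

(** Merges the three recurrences: any node c that carries a pole may be used to write z = (z - c) +
    c. Both the vanishing and the size of [hres] follow from this single rule. *)
Lemma hres_step a1 a2 m0 m1 m2 : nodes_ok a1 a2 -> (0 < m0 + m1 + m2)%nat ->
  exists p0 p1 p2 c, (S (p0 + p1 + p2) = m0 + m1 + m2)%nat /\ 0 <= c <= a2 /\
  forall n, hres a1 a2 m0 m1 m2 (S n) = hres a1 a2 p0 p1 p2 n + c * hres a1 a2 m0 m1 m2 n.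
Proof.
  intros H Hpos. destruct m0 as [|m0]; [destruct m1 as [|m1]; [destruct m2 as [|m2]; [lia|]|]|].
  - exists 0%nat, 0%nat, m2, a2. repeat split; [nodes_lra|nodes_lra|].
    intro n. now apply hres_S2.
  - exists 0%nat, m1, m2, a1. repeat split; [nodes_lra|nodes_lra|].
    intro n. now apply hres_S1.
  - exists m0, m1, m2, 0. repeat split; [nodes_lra|nodes_lra|].
    intro n. rewrite hres_S0 by assumption. ring.
Qed.

(** With s the total pole order, the function decays like z^(n - s), so it has no residue at
    infinity when n < s - 1. *)
Lemma hres_vanish a1 a2 m0 m1 m2 n : nodes_ok a1 a2 -> (n + 1 < m0 + m1 + m2)%nat ->
  hres a1 a2 m0 m1 m2 n = 0.
Proof.
  intro H. revert m0 m1 m2. induction n as [|n IH]; intros m0 m1 m2 Hn.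
  - rewrite hres_0 by (assumption || lia).
    now rewrite (proj2 (Nat.eqb_neq _ _)) by lia.
  - destruct (hres_step a1 a2 m0 m1 m2) as (p0 & p1 & p2 & c & Hp & _ & E); [assumption|lia|].
    rewrite E, !IH by lia. ring.
Qed.

Lemma hres_none a1 a2 n : hres a1 a2 0 0 0 n = 0.
Proof. unfold hres, res. simpl. ring. Qed.

(** [hres] at n is the complete homogeneous symmetric polynomial of degree n - s + 1 in the nodes
    with multiplicity. Its generating function is x^(s - 1) over the product of the (1 - a_i x)^m_i,
    and each factor 1 - a_i x is at least 1 - a2 x. *)
Lemma hres_sum_bound a1 a2 x m0 m1 m2 M :
  nodes_ok a1 a2 -> 0 < x -> a2 * x < 1 -> (0 < m0 + m1 + m2)%nat ->
  sum_f_R0 (fun n => Rabs (hres a1 a2 m0 m1 m2 n) * x ^ n) M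
  <= x ^ (m0 + m1 + m2 - 1) / (1 - a2 * x) ^ (m0 + m1 + m2).
Proof.
  intros H Hx Hax. remember (m0 + m1 + m2)%nat as s eqn:Hs. revert m0 m1 m2 Hs.
  induction s as [|s IH]; intros m0 m1 m2 Hs Hpos; [lia|].
  destruct (hres_step a1 a2 m0 m1 m2) as (p0 & p1 & p2 & c & Hp & Hc & E); [assumption|lia|].
  set (T m := sum_f_R0 (fun n => Rabs (hres a1 a2 m0 m1 m2 n) * x ^ n) m).
  set (T' m := sum_f_R0 (fun n => Rabs (hres a1 a2 p0 p1 p2 n) * x ^ n) m).
  change (T M <= x ^ (S s - 1) / (1 - a2 * x) ^ S s).
  assert (Hmono : forall m, 0 <= T m /\ T m <= T (S m)).
  { intro m. split.
    - apply cond_pos_sum. intro n. apply Rmult_le_pos; [apply Rabs_pos|apply pow_le; lra].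
    - unfold T. simpl.
      assert (0 <= Rabs (hres a1 a2 m0 m1 m2 (S m)) * (x * x ^ m)); [|lra].
      apply Rmult_le_pos; [apply Rabs_pos|]. apply (pow_le x (S m)); lra. }
  (* The recurrence summed over n. As T M is at most T (S M), it gives (1 - a2 x) T M <= |hres 0| +
     x T' M. *)
  assert (Hrec : T (S M) <= Rabs (hres a1 a2 m0 m1 m2 0) + x * T' M + a2 * x * T M).
  { unfold T at 1. rewrite decomp_sum by lia. simpl pred. simpl pow at 1.
    rewrite Rmult_1_r, Rplus_assoc. apply Rplus_le_compat_l.
    unfold T', T. rewrite !scal_sum, <- sum_plus. apply sum_Rle. intros n _.
    rewrite E. simpl pow.
    pose proof (Rabs_triang (hres a1 a2 p0 p1 p2 n) (c * hres a1 a2 m0 m1 m2 n)) as Ht.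
    rewrite Rabs_mult, (Rabs_pos_eq c) in Ht by lra.
    assert (Hxn : 0 <= x * x ^ n) by (apply (pow_le x (S n)); lra).
    pose proof (Rabs_pos (hres a1 a2 m0 m1 m2 n)).
    assert (c * Rabs (hres a1 a2 m0 m1 m2 n) <= a2 * Rabs (hres a1 a2 m0 m1 m2 n))
      by (apply Rmult_le_compat_r; lra).
    transitivity ((Rabs (hres a1 a2 p0 p1 p2 n) + a2 * Rabs (hres a1 a2 m0 m1 m2 n)) * (x * x ^ n)).
    - apply Rmult_le_compat_r; lra.
    - lra. }
  destruct (Hmono M) as [_ Hm].
  rewrite hres_0, <- Hs in Hrec by (assumption || lia).
  assert (Hq : 0 < (1 - a2 * x) ^ s) by (apply pow_lt; lra).
  (* For total order one, no pole is left in T' and the initial value 1 is the whole bound; for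
     higher order the initial value is 0 and only T' contributes. *)
  destruct s as [|s].
  - assert (Hz : T' M = 0).
    { unfold T'. replace p0 with 0%nat by lia. replace p1 with 0%nat by lia.
      replace p2 with 0%nat by lia. rewrite <- (Rmult_0_l (sum_f_R0 (fun n => x ^ n) M)), scal_sum.
      apply sum_eq. intros i _. rewrite hres_none, Rabs_R0. ring. }
    rewrite Hz in Hrec. simpl in Hrec. rewrite Rabs_R1 in Hrec. simpl.
    apply Rle_div_r; lra.
  - rewrite (proj2 (Nat.eqb_neq _ _)) in Hrec by lia. rewrite Rabs_R0 in Hrec.
    assert (HT : T' M <= x ^ (S s - 1) / (1 - a2 * x) ^ S s)
      by (apply (IH p0 p1 p2); lia).
    replace (S (S s) - 1)%nat with (S (S s - 1)) by lia.
    replace (x ^ S (S s - 1) / (1 - a2 * x) ^ S (S s)) with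
      (x * (x ^ (S s - 1) / (1 - a2 * x) ^ S s) / (1 - a2 * x)).
    2:{ simpl. field. split; [|lra]. apply pow_nonzero; lra. }
    apply Rle_div_r; [lra|].
    apply (Rmult_le_compat_l x) in HT; lra.
Qed.

(** * Majorants *)

(** A bound on the weighted l1 norm of radius r. It is submultiplicative and takes the place of the
    maximum modulus on |t| = r in Cauchy's estimate. *)
Definition maj (r : R) (a : ser) (C : R) : Prop :=
  forall M, sum_f_R0 (fun i => Rabs (a i) * r ^ i) M <= C.

Lemma maj_coef r a C n : 0 <= r -> maj r a C -> Rabs (a n) * r ^ n <= C.
Proof.
  intros Hr H. eapply Rle_trans; [|apply (H n)].
  assert (Hp : forall i, 0 <= Rabs (a i) * r ^ i)
    by (intro i; apply Rmult_le_pos; [apply Rabs_pos|now apply pow_le]).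
  destruct n as [|n]; [simpl; lra|]. rewrite tech5.
  pose proof (cond_pos_sum (fun i => Rabs (a i) * r ^ i) n Hp). lra.
Qed.

Lemma maj_pos r a C : maj r a C -> 0 <= C.
Proof.
  intro H. specialize (H 0%nat). simpl in H. pose proof (Rabs_pos (a 0%nat)). lra.
Qed.

(** Peeling off the constant coefficient of [a] passes from truncation M + 1 to the tail of [a] at
    truncation M, so partial sums suffice; hence the induction is over all [a] at once. *)
Lemma maj_mul r a b C D : 0 <= r -> maj r a C -> maj r b D -> maj r (a * b)%ser (C * D).
Proof.
  intros Hr Ha Hb M. pose proof (maj_pos _ _ _ Hb) as HD.
  assert (Hmain : forall M a,
    sum_f_R0 (fun i => Rabs (smul a b i) * r ^ i) M
    <= sum_f_R0 (fun i => Rabs (a i) * r ^ i) M * D).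
  { clear M a Ha. intro M. induction M as [|M IH]; intro a.
    - simpl. rewrite smul_0, Rabs_mult, !Rmult_1_r.
      apply Rmult_le_compat_l; [apply Rabs_pos|].
      specialize (Hb 0%nat). simpl in Hb. lra.
    - rewrite (decomp_sum (fun i => Rabs (a i) * r ^ i)) by lia.
      rewrite (decomp_sum (fun i => Rabs (smul a b i) * r ^ i)) by lia. simpl pred.
      transitivity (Rabs (a 0%nat) * sum_f_R0 (fun i => Rabs (b i) * r ^ i) (S M)
        + r * sum_f_R0 (fun i => Rabs (smul (stl a) b i) * r ^ i) M).
      + rewrite (decomp_sum (fun i => Rabs (b i) * r ^ i)) by lia. simpl pred.
        rewrite Rmult_plus_distr_l, smul_0, Rabs_mult, Rplus_assoc.
        apply Rplus_le_compat; [lra|]. rewrite !scal_sum, <- sum_plus.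
        apply sum_Rle. intros i _. rewrite smul_S.
        pose proof (Rabs_triang (a 0%nat * b (S i)) (smul (stl a) b i)) as Ht.
        rewrite Rabs_mult in Ht. assert (Hq : 0 <= r ^ S i) by now apply pow_le.
        apply (Rmult_le_compat_r (r ^ S i)) in Ht; [|assumption]. simpl in *. lra.
      + rewrite Rmult_plus_distr_r. apply Rplus_le_compat.
        * rewrite Rmult_1_r. apply Rmult_le_compat_l; [apply Rabs_pos|apply Hb].
        * eapply Rle_trans; [apply Rmult_le_compat_l; [assumption|apply IH]|].
          apply Req_le. rewrite <- Rmult_assoc. f_equal. rewrite scal_sum.
          apply sum_eq. intros i _. unfold stl. simpl. ring. }
  eapply Rle_trans; [apply Hmain|]. now apply Rmult_le_compat_r.
Qed.

Lemma maj_scst r c : maj r (scst c) (Rabs c).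
Proof.
  intro M. induction M as [|M IH]; simpl in *; [lra|]. rewrite Rabs_R0. lra.
Qed.

Lemma maj_pow r a C n : 0 <= r -> maj r a C -> maj r (a ^ n)%ser (C ^ n).
Proof.
  intros Hr H. induction n as [|n IH]; simpl.
  - pose proof (maj_scst r 1) as H1. now rewrite Rabs_R1 in H1.
  - now apply maj_mul.
Qed.

Lemma maj_linear r c d : 0 <= r -> maj r (scst c + scst d * svar)%ser (Rabs c + Rabs d * r).
Proof.
  intros Hr M.
  assert (E : forall i, (scst c + scst d * svar)%ser i
     = match i with O => c | 1%nat => d | _ => 0 end).
  { intro i. unfold sadd. rewrite smul_scst. destruct i as [|[|i]]; simpl; ring. }
  assert (0 <= Rabs d * r) by (apply Rmult_le_pos; [apply Rabs_pos|assumption]).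
  pose proof (Rabs_pos c).
  induction M as [|M IH]; simpl; rewrite E; [lra|].
  destruct M as [|M].
  - simpl. rewrite E. lra.
  - rewrite Rabs_R0. lra.
Qed.

Lemma maj_geom r a q c : 0 <= r -> 0 <= c -> 0 <= q -> q < 1 ->
  (forall n, Rabs (a n) * r ^ n <= c * q ^ n) -> maj r a (c / (1 - q)).
Proof.
  intros Hr Hc Hq Hq1 H M.
  apply Rle_trans with (c * sum_f_R0 (fun n => q ^ n) M).
  - rewrite scal_sum. apply sum_Rle. intros n _. specialize (H n). lra.
  - rewrite tech3 by lra. unfold Rdiv. rewrite <- Rmult_assoc.
    apply Rmult_le_compat_r; [apply Rlt_le, Rinv_0_lt_compat; lra|].
    pose proof (pow_le q (S M) Hq). nra.
Qed.

Lemma maj_sinv r d : 0 <= r -> r < Rabs d -> maj r (sinv d) (/ (Rabs d - r)).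
Proof.
  intros Hr Hd. replace (/ (Rabs d - r)) with ((/ Rabs d) / (1 - r / Rabs d))
    by (field; lra).
  assert (Hi : 0 < / Rabs d) by (apply Rinv_0_lt_compat; lra).
  apply maj_geom; try lra.
  - apply Rmult_le_pos; lra.
  - apply Rlt_div_l; lra.
  - intro n. unfold sinv. rewrite Rabs_div by (apply pow_nonzero; intros ->; rewrite Rabs_R0 in Hd; lra).
    rewrite pow_1_abs, <- RPow_abs. unfold Rdiv. rewrite Rpow_mult_distr, pow_inv.
    simpl. rewrite Rinv_mult. apply Req_le. ring.
Qed.

(** * Binomial series *)

Fixpoint bin (al : R) (n : nat) : R :=
  match n with O => 1 | S n => bin al n * (al - INR n) / (INR n + 1) end.

Lemma bin_S al n : (INR n + 1) * bin al (S n) = bin al n * (al - INR n).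
Proof. simpl bin. pose proof (pos_INR n). field. lra. Qed.

Lemma bin_absorb al n : (INR n + 1) * bin (al + 1) (S n) = (al + 1) * bin al n.
Proof.
  induction n as [|n IH].
  - simpl. field.
  - rewrite bin_S. pose proof (pos_INR n). rewrite S_INR.
    apply (Rmult_eq_reg_l (INR n + 1)); [|lra].
    rewrite <- Rmult_assoc, IH, (Rmult_comm (al + 1) (bin al (S n))), <- Rmult_assoc, bin_S.
    ring.
Qed.

Lemma bin_pascal al n : bin (al + 1) (S n) = bin al (S n) + bin al n.
Proof.
  pose proof (pos_INR n). apply (Rmult_eq_reg_l (INR n + 1)); [|lra].
  rewrite bin_absorb, Rmult_plus_distr_l, bin_S. ring.
Qed.

(** The ratio of consecutive terms is |al - n| / (n + 1), which is at most 1 once -1 <= al <= 2n +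
    1. *)
Lemma bin_decr al m n : -1 <= al -> al <= 2 * INR m + 1 -> (m <= n)%nat ->
  Rabs (bin al n) <= Rabs (bin al m).
Proof.
  intros H0 H1 Hmn. induction Hmn as [|n Hmn IH]; [lra|].
  eapply Rle_trans; [|exact IH]. apply le_INR in Hmn. pose proof (pos_INR m).
  simpl bin. unfold Rdiv. rewrite Rmult_assoc, Rabs_mult.
  rewrite <- (Rmult_1_r (Rabs (bin al n))) at 2.
  apply Rmult_le_compat_l; [apply Rabs_pos|].
  change ((al - INR n) * / (INR n + 1)) with ((al - INR n) / (INR n + 1)).
  rewrite Rabs_div by lra. rewrite (Rabs_pos_eq (INR n + 1)) by lra.
  apply Rle_div_l; [lra|]. apply Rabs_le. lra.
Qed.

Lemma bin_half_le n : Rabs (bin (1/2) n) <= 1.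
Proof.
  replace 1 with (Rabs (bin (1/2) 0)) at 2 by apply Rabs_R1.
  apply bin_decr; simpl; lra || lia.
Qed.

(** Pascal's rule at most doubles the bound at each step. This crude estimate serves only for
    convergence. *)
Lemma bin_bound k n : Rabs (bin (INR k + 1/2) n) <= 2 ^ k.
Proof.
  revert n. induction k as [|k IH]; intro n.
  - simpl INR. rewrite Rplus_0_l. apply bin_half_le.
  - rewrite S_INR. replace (INR k + 1 + 1/2) with (INR k + 1/2 + 1) by ring.
    destruct n as [|n].
    + simpl. rewrite Rabs_R1. pose proof (pow_R1_Rle 2 k). lra.
    + rewrite bin_pascal. eapply Rle_trans; [apply Rabs_triang|].
      pose proof (IH n). pose proof (IH (S n)). change (2 ^ S k) with (2 * 2 ^ k). lra.
Qed.

(** From k to k + 1 the absolute value is multiplied by a rational function of k that stays below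
    its limit 4/27. The factor 27/64 makes k = 1 an equality, both sides being 1/16. *)
Lemma bin_3k k : (1 <= k)%nat ->
  Rabs (bin (INR k + 1/2) (3 * k)) <= 27 / 64 * (4 / 27) ^ k.
Proof.
  intro Hk. induction Hk as [|k Hk IH].
  - simpl. rewrite Rabs_left; lra.
  - rewrite S_INR. replace (INR k + 1 + 1/2) with (INR k + 1/2 + 1) by ring.
    replace (3 * S k)%nat with (S (S (S (3 * k)))) by lia.
    set (b := bin (INR k + 1/2) (3 * k)) in *.
    apply le_INR in Hk. simpl (INR 1) in Hk.
    assert (E3 : INR (3 * k) = 3 * INR k) by (rewrite mult_INR; simpl; ring).
    assert (E : bin (INR k + 1/2 + 1) (S (S (S (3 * k)))) =
      b * ((INR k + 3/2) * (2 * INR k - 1/2) * (2 * INR k + 1/2)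
           / ((3 * INR k + 1) * (3 * INR k + 2) * (3 * INR k + 3)))).
    { pose proof (bin_absorb (INR k + 1/2) (S (S (3 * k)))) as H1.
      pose proof (bin_S (INR k + 1/2) (S (3 * k))) as H2.
      pose proof (bin_S (INR k + 1/2) (3 * k)) as H3. fold b in H3.
      rewrite !S_INR, !E3 in *.
      apply (Rmult_eq_reg_l ((3 * INR k + 1 + 1 + 1) * ((3 * INR k + 1 + 1) * (3 * INR k + 1))));
        [|apply Rgt_not_eq; repeat apply Rmult_lt_0_compat; lra].
      rewrite Rmult_assoc, (Rmult_comm _ (bin (INR k + 1/2 + 1) _)), <- Rmult_assoc, H1.
      transitivity ((INR k + 1/2 + 1) * (3 * INR k + 1)
        * ((3 * INR k + 1 + 1) * bin (INR k + 1/2) (S (S (3 * k))))); [ring|].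
      rewrite H2.
      transitivity ((INR k + 1/2 + 1) * (INR k + 1/2 - (3 * INR k + 1))
        * ((3 * INR k + 1) * bin (INR k + 1/2) (S (3 * k)))); [ring|].
      rewrite H3. field. lra. }
    rewrite E, Rabs_mult.
    replace (27 / 64 * (4 / 27) ^ S k) with (27 / 64 * (4 / 27) ^ k * (4 / 27)) by (simpl; ring).
    apply Rmult_le_compat; try apply Rabs_pos; [assumption|].
    assert (Hd : 0 < (3 * INR k + 1) * (3 * INR k + 2) * (3 * INR k + 3))
      by (apply Rmult_lt_0_compat; [apply Rmult_lt_0_compat|]; lra).
    rewrite Rabs_pos_eq.
    + apply Rle_div_l; [assumption|]. nra.
    + apply Rmult_le_pos; [|apply Rlt_le, Rinv_0_lt_compat; assumption].
      apply Rmult_le_pos; [apply Rmult_le_pos|]; lra.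
Qed.

(* The expansion of sqrt (1 + y t). *)
Definition sqrt_ser (y : R) : ser := fun n => bin (1/2) n * y ^ n.

Lemma sqrt_ser_euler y :
  ((scst 1 + scst y * svar) * seuler (sqrt_ser y) = scst (1/2 * y) * svar * sqrt_ser y)%ser.
Proof.
  apply functional_extensionality; intro n.
  rewrite smul_add_l. unfold sadd. rewrite smul_scst, <- !smul_assoc, !smul_scst.
  destruct n as [|n].
  - rewrite !smul_0. unfold seuler. simpl. ring.
  - rewrite !svar_mul_S. unfold seuler, sqrt_ser. rewrite S_INR.
    transitivity ((INR n + 1) * bin (1/2) (S n) * y ^ S n + y * (INR n * (bin (1/2) n * y ^ n)));
      [ring|].
    rewrite bin_S. simpl pow. ring.
Qed.

(** The square satisfies (1 + y t) f' = y f. The resulting recurrence (n + 1) f_(n+1) = y (1 - n)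
    f_n stops after degree one. *)
Lemma sqrt_ser_sqr y : (sqrt_ser y * sqrt_ser y = scst 1 + scst y * svar)%ser.
Proof.
  pose proof (sqrt_ser_euler y) as E. set (s := sqrt_ser y) in *.
  assert (E2 : ((scst 1 + scst y * svar) * seuler (s * s) = scst y * svar * (s * s))%ser).
  { rewrite seuler_mul.
    transitivity (s * ((scst 1 + scst y * svar) * seuler s)
       + ((scst 1 + scst y * svar) * seuler s) * s)%ser; [ring|].
    rewrite E. replace y with (1/2 * y + 1/2 * y) at 3 by field. rewrite scst_add. ring. }
  assert (Hc : forall n, (INR n + 1) * (s * s)%ser (S n) = y * (1 - INR n) * (s * s)%ser n).
  { intro n. apply (f_equal (fun f => f (S n))) in E2.
    rewrite smul_add_l in E2. unfold sadd in E2.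
    rewrite smul_scst, <- !smul_assoc, !smul_scst, !svar_mul_S in E2.
    unfold seuler in E2. rewrite S_INR in E2. lra. }
  assert (Hz : forall n, (s * s)%ser (S (S n)) = 0).
  { induction n as [|n IH].
    - specialize (Hc 1%nat). simpl INR in Hc. lra.
    - specialize (Hc (S (S n))). rewrite IH in Hc.
      rewrite !S_INR in Hc. pose proof (pos_INR n).
      apply (Rmult_eq_reg_l (INR n + 1 + 1 + 1)); [lra|lra]. }
  assert (H0 : (s * s)%ser 0%nat = 1) by (rewrite smul_0; unfold s, sqrt_ser; simpl; ring).
  apply functional_extensionality; intro n. unfold sadd. rewrite smul_scst.
  destruct n as [|[|n]]; [rewrite H0; simpl; ring| |rewrite Hz; simpl; ring].
  specialize (Hc 0%nat). rewrite H0 in Hc. simpl INR in Hc. simpl scst. simpl svar. lra.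
Qed.

(** * Convergence of the binomial series *)

(* [is_series_ext] leaves equations in the carrier of [R_NormedModule]. *)
Ltac eqR := lazymatch goal with |- ?a = ?b => change (@eq R a b) end.

Lemma is_series_lin (a b : nat -> R) (la lb c d : R) :
  is_series a la -> is_series b lb ->
  is_series (fun n => c * a n + d * b n) (c * la + d * lb).
Proof.
  intros Ha Hb. apply (is_series_plus (fun n => c * a n) (fun n => d * b n)).
  - now apply (is_series_scal c a la).
  - now apply (is_series_scal d b lb).
Qed.

Lemma is_series_tail (a : nat -> R) (l : R) :
  is_series a l -> is_series (fun n => a (S n)) (l - a 0%nat).
Proof.
  intro H. apply (is_series_incr_1 a). change (is_series a (l - a 0%nat + a 0%nat)).
  now replace (l - a 0%nat + a 0%nat) with l by ring.
Qed.

Lemma is_series_cons (a : nat -> R) (l : R) :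
  is_series (fun n => a (S n)) (l - a 0%nat) -> is_series a l.
Proof. intro H. apply (is_series_decr_1 a). exact H. Qed.

Lemma ex_series_dom (a : nat -> R) (C q : R) : 0 <= q < 1 ->
  (forall n, Rabs (a n) <= C * q ^ n) -> ex_series (fun n => Rabs (a n)).
Proof.
  intros Hq H. apply (@ex_series_le R_AbsRing R_CompleteNormedModule _ (fun n => C * q ^ n)).
  - intro n. change (Rabs (Rabs (a n)) <= C * q ^ n). rewrite Rabs_Rabsolu. apply H.
  - apply (ex_series_scal C (fun n => q ^ n)). apply ex_series_geom.
    rewrite Rabs_pos_eq; lra.
Qed.

Lemma is_series_sqrt y : 0 <= y <= 1/4 ->
  is_series (sqrt_ser y) (sqrt (1 + y)).
Proof.
  intro Hy. set (s := sqrt_ser y).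
  assert (Hb : forall n, Rabs (s n) <= 1 * y ^ n).
  { intro n. unfold s, sqrt_ser. rewrite Rabs_mult, (Rabs_pos_eq (y ^ n)) by (apply pow_le; lra).
    apply Rmult_le_compat_r; [apply pow_le; lra|apply bin_half_le]. }
  assert (Ha : ex_series (fun n => Rabs (s n))) by (apply (ex_series_dom _ 1 y); [lra|assumption]).
  pose proof (ex_series_Rabs s Ha) as Hs. apply Series_correct in Hs.
  set (l := Series s) in *.
  assert (Hsq : l * l = 1 + y).
  { pose proof (is_series_mult s s l l Hs Hs Ha Ha) as Hm.
    change (is_series (smul s s) (l * l)) in Hm. unfold s in Hm. rewrite sqrt_ser_sqr in Hm.
    (* By [sqrt_ser_sqr] only two coefficients of the Cauchy product are nonzero; once they are
       removed the zero series remains. *)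
    apply is_series_tail, is_series_tail in Hm.
    assert (H0 : is_series (fun n => 0 * s n + 0 * s n) (0 * l + 0 * l))
      by now apply is_series_lin.
    apply is_series_unique in Hm. apply is_series_unique in H0.
    rewrite <- (Series_ext (fun n => 0 * s n + 0 * s n)), H0 in Hm.
    2:{ intro n. unfold sadd. rewrite smul_scst. simpl. ring. }
    unfold sadd in Hm. rewrite !smul_scst in Hm. simpl in Hm. lra. }
  (* The sign of the root: l differs from the constant term 1 by at most y / (1 - y) <= 1. *)
  assert (Hpos : 0 <= l).
  { assert (Hg : ex_series (fun n => y * y ^ n)).
    { apply (ex_series_scal y (fun n => y ^ n)). apply ex_series_geom.
      rewrite Rabs_pos_eq; lra. }
    assert (Hle : Rabs (Series (fun n => s (S n))) <= Series (fun n => y * y ^ n)).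
    { eapply Rle_trans; [apply Series_Rabs|apply Series_le; [|assumption]].
      - now apply (ex_series_incr_1 (fun n => Rabs (s n))).
      - intro n. split; [apply Rabs_pos|]. specialize (Hb (S n)). simpl pow in Hb. lra. }
    rewrite Series_scal_l, Series_geom in Hle by (rewrite Rabs_pos_eq; lra).
    pose proof (is_series_tail _ _ Hs) as Ht. apply is_series_unique in Ht.
    rewrite Ht in Hle. change (s 0%nat) with (1 * 1) in Hle. rewrite Rmult_1_r in Hle.
    assert (y * / (1 - y) <= 1) by (apply Rle_div_l; lra).
    apply Rabs_le_between in Hle. lra. }
  replace (sqrt (1 + y)) with l; [assumption|].
  rewrite <- Hsq, sqrt_square; lra.
Qed.

(** Pascal's rule is multiplication by 1 + y, which reduces the exponent to 1/2. *)
Lemma is_series_bin k y : 0 <= y <= 1/4 ->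
  is_series (fun n => bin (INR k + 1/2) n * y ^ n) ((1 + y) ^ k * sqrt (1 + y)).
Proof.
  intro Hy. induction k as [|k IH].
  - simpl. rewrite Rmult_1_l, Rplus_0_l. now apply is_series_sqrt.
  - apply is_series_cons. rewrite S_INR.
    replace (INR k + 1 + 1/2) with (INR k + 1/2 + 1) by ring.
    set (v := fun n => bin (INR k + 1/2) n * y ^ n) in *.
    set (l := (1 + y) ^ k * sqrt (1 + y)) in *.
    apply (is_series_ext (fun n => 1 * v (S n) + y * v n)).
    { intro n. eqR. unfold v. rewrite bin_pascal. simpl pow. ring. }
    assert (E : 1 * (l - v 0%nat) + y * l
      = (1 + y) ^ S k * sqrt (1 + y) - bin (INR k + 1/2 + 1) 0 * y ^ 0)
      by (unfold l, v; simpl; ring).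
    rewrite <- E.
    apply is_series_lin; [now apply is_series_tail|assumption].
Qed.

(** * Expansions of (1 + z x)^(k + 1/2) at the nodes *)

(* The expansion at z = a, divided by sqrt (1 + a x): the coefficients are then rational in x. *)
Definition gser (a x : R) (k : nat) : ser :=
  ((scst (1 + a * x) + scst x * svar) ^ k
   * sqrt_ser (x / (1 + a * x)))%ser.

Lemma gser_0 a x k : gser a x k 0%nat = (1 + a * x) ^ k.
Proof.
  unfold gser. rewrite smul_0. unfold sqrt_ser. simpl.
  assert (E : (spow (scst (1 + a * x) + scst x * svar) k) 0%nat = (1 + a * x) ^ k).
  { induction k as [|k IH]; simpl; [reflexivity|]. rewrite smul_0, IH.
    unfold sadd. rewrite smul_scst. simpl. ring. }
  rewrite E. ring.
Qed.

Lemma gser_euler a x k : 1 + a * x <> 0 ->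
  ((scst (1 + a * x) + scst x * svar) * seuler (gser a x k)
   = scst ((INR k + 1/2) * x) * svar * gser a x k)%ser.
Proof.
  intro He. unfold gser. set (e := 1 + a * x) in *.
  set (s := sqrt_ser (x / e)).
  set (E := (scst e + scst x * svar)%ser).
  assert (HE : E = (scst e * (scst 1 + scst (x / e) * svar))%ser).
  { unfold E. replace x with (e * (x / e)) at 1 by (field; assumption).
    rewrite scst_mul. ring. }
  assert (Hs : (E * seuler s = scst (1/2 * x) * svar * s)%ser).
  { unfold s. rewrite HE, <- smul_assoc, sqrt_ser_euler.
    replace (1/2 * x) with (e * (1/2 * (x / e))) by (field; assumption).
    rewrite !scst_mul. ring. }
  assert (HEe : seuler E = (scst x * svar)%ser).
  { unfold E. rewrite seuler_add, seuler_mul, !seuler_scst, seuler_svar. ring. }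
  rewrite seuler_mul.
  transitivity ((E * seuler (E ^ k)) * s + E ^ k * (E * seuler s))%ser; [ring|].
  rewrite seuler_pow, HEe, Hs, Rmult_plus_distr_r, scst_add, !scst_mul. ring.
Qed.

Lemma gser_rec a x k h : 1 + a * x <> 0 ->
  (1 + a * x) * (INR h + 1) * gser a x k (S h) = (INR k + 1/2 - INR h) * x * gser a x k h.
Proof.
  intro He. pose proof (gser_euler a x k He) as E.
  apply (f_equal (fun f => f (S h))) in E. rewrite smul_add_l in E. unfold sadd in E.
  rewrite <- !smul_assoc, !smul_scst, !svar_mul_S in E. unfold seuler in E.
  rewrite S_INR in E. lra.
Qed.

Lemma seuler_node a : seuler (node a) = svar.
Proof. unfold node. rewrite seuler_add, seuler_scst, seuler_svar. ring. Qed.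

Lemma node_pow_S a n h :
  (INR h + 1) * (node a ^ S n)%ser (S h) = (INR n + 1) * (node a ^ n)%ser h.
Proof.
  assert (E : (seuler (node a ^ S n) = scst (INR n + 1) * (svar * node a ^ n))%ser).
  { simpl spow. rewrite seuler_mul, seuler_pow, seuler_node, scst_add. ring. }
  apply (f_equal (fun f => f (S h))) in E.
  rewrite smul_scst, svar_mul_S in E. unfold seuler in E. now rewrite S_INR in E.
Qed.

Lemma node_pow_euler a n h :
  a * (INR h + 1) * (node a ^ n)%ser (S h) + INR h * (node a ^ n)%ser h
  = INR n * (node a ^ n)%ser h.
Proof.
  pose proof (seuler_pow (node a) n) as E. rewrite seuler_node in E.
  apply (f_equal (fun f => f (S h))) in E. unfold node at 1 in E.
  rewrite smul_add_l, <- smul_assoc in E. unfold sadd at 1 in E.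
  rewrite !smul_scst, !svar_mul_S in E. unfold seuler in E. rewrite S_INR in E. lra.
Qed.

Lemma node_pow_bound a n h : 0 <= a -> Rabs ((node a ^ n)%ser h) <= (a + 1) ^ n.
Proof.
  intro Ha.
  assert (H : maj 1 (node a) (a + 1)).
  { replace (node a) with (scst a + scst 1 * svar)%ser by (unfold node; ring).
    replace (a + 1) with (Rabs a + Rabs 1 * 1)
      by (rewrite Rabs_R1, Rabs_pos_eq by assumption; ring).
    apply maj_linear; lra. }
  apply (maj_pow 1 _ _ n) in H; [|lra]. apply (maj_coef 1 _ _ h) in H; [|lra].
  rewrite pow1 in H. lra.
Qed.

(** Takes the h-th Taylor coefficient at z = a of the power series of (1 + x z)^(k + 1/2) term by
    term. No series is differentiated: by induction on h, the sums obey the recurrence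
    [gser_rec]. *)
Lemma jet_series a x k h : 0 <= a -> 0 < x -> (a + 1) * x <= 1/4 ->
  is_series (fun n => bin (INR k + 1/2) n * x ^ n * (node a ^ n)%ser h)
            (sqrt (1 + a * x) * gser a x k h).
Proof.
  intros Ha Hx Hax. set (al := INR k + 1/2).
  assert (Hax0 : 0 <= a * x) by (apply Rmult_le_pos; lra).
  induction h as [|h IH].
  - rewrite gser_0. rewrite Rmult_comm.
    apply (is_series_ext (fun n => bin al n * (a * x) ^ n)).
    { intro n. eqR. rewrite Rpow_mult_distr.
      assert (E : (node a ^ n)%ser 0%nat = a ^ n).
      { induction n as [|n IH]; simpl; [reflexivity|]. rewrite smul_0, IH.
        unfold node, sadd. simpl. ring. }
      rewrite E. ring. }
    apply is_series_bin. lra.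
  - set (v := fun n => bin al n * x ^ n * (node a ^ n)%ser h) in *.
    set (u := fun n => bin al n * x ^ n * (node a ^ n)%ser (S h)).
    assert (Hu : ex_series u).
    { apply ex_series_Rabs, (ex_series_dom _ (2 ^ k) ((a + 1) * x)).
      - split; [apply Rmult_le_pos; lra|lra].
      - intro n. unfold u. rewrite !Rabs_mult, (Rabs_pos_eq (x ^ n)) by (apply pow_le; lra).
        rewrite Rpow_mult_distr, Rmult_assoc, (Rmult_comm (x ^ n)).
        apply Rmult_le_compat; [apply Rabs_pos| |apply bin_bound|].
        + apply Rmult_le_pos; [apply Rabs_pos|apply pow_le; lra].
        + apply Rmult_le_compat_r; [apply pow_le; lra|now apply node_pow_bound]. }
    apply Series_correct in Hu. set (U := Series u) in *.
    (* As the zeroth term of u vanishes, the shifted series also sums to U; writing it through v and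
       u gives a linear equation for U. *)
    assert (Hrec : is_series (fun n => u (S n))
       (x * (al - INR h) / (INR h + 1) * (sqrt (1 + a * x) * gser a x k h) + (- a * x) * U)).
    { apply (is_series_ext (fun n => x * (al - INR h) / (INR h + 1) * v n + (- a * x) * u n));
        [|now apply is_series_lin].
      intro n. eqR. pose proof (pos_INR h). pose proof (pos_INR n).
      apply (Rmult_eq_reg_l (INR h + 1)); [|lra].
      unfold u, v.
      transitivity (bin al (S n) * ((INR h + 1) * (node a ^ S n)%ser (S h)) * x ^ S n); [|ring].
      rewrite node_pow_S.
      transitivity (((INR n + 1) * bin al (S n)) * (node a ^ n)%ser h * x ^ S n); [|ring].
      rewrite bin_S. pose proof (node_pow_euler a n h) as E. simpl pow.
      transitivity (bin al n * (x * x ^ n) * ((al - INR h) * (node a ^ n)%ser h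
        - a * (INR h + 1) * (node a ^ n)%ser (S h))); [field; lra|].
      replace (a * (INR h + 1) * (node a ^ n)%ser (S h)) with
        ((INR n - INR h) * (node a ^ n)%ser h) by lra. ring. }
    pose proof (is_series_tail u U Hu) as Ht.
    apply is_series_unique in Hrec. apply is_series_unique in Ht. rewrite Hrec in Ht.
    assert (H0 : u 0%nat = 0) by (unfold u; simpl; ring).
    rewrite H0 in Ht. pose proof (pos_INR h).
    replace (sqrt (1 + a * x) * gser a x k (S h)) with U; [assumption|].
    apply (Rmult_eq_reg_l ((1 + a * x) * (INR h + 1))).
    2:{ apply Rgt_not_eq, Rmult_lt_0_compat; lra. }
    transitivity (sqrt (1 + a * x) * ((1 + a * x) * (INR h + 1) * gser a x k (S h))); [|ring].
    rewrite gser_rec by lra. fold al.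
    assert (Ht2 : (1 + a * x) * U
      = x * (al - INR h) / (INR h + 1) * (sqrt (1 + a * x) * gser a x k h)) by lra.
    rewrite (Rmult_comm (1 + a * x)), Rmult_assoc, Ht2. field. lra.
Qed.

Lemma is_series_smul (u : nat -> ser) (v w : ser) s :
  (forall h, is_series (fun n => u n h) (v h)) ->
  is_series (fun n => (u n * w)%ser s) ((v * w)%ser s).
Proof.
  intro H. unfold smul.
  assert (G : forall f : nat -> R, forall m,
    is_series (fun n => sum_f_R0 (fun i => u n i * f i) m) (sum_f_R0 (fun i => v i * f i) m)).
  { intros f m. induction m as [|m IH]; simpl.
    - apply (is_series_ext (fun n => f 0%nat * u n 0%nat + 0 * u n 0%nat)); [intro; eqR; ring|].
      replace (v 0%nat * f 0%nat) with (f 0%nat * v 0%nat + 0 * v 0%nat) by ring.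
      now apply is_series_lin.
    - apply (is_series_ext (fun n => 1 * sum_f_R0 (fun i => u n i * f i) m + f (S m) * u n (S m)));
        [intro; eqR; ring|].
      replace (sum_f_R0 (fun i => v i * f i) m + v (S m) * f (S m)) with
        (1 * sum_f_R0 (fun i => v i * f i) m + f (S m) * v (S m)) by ring.
      now apply is_series_lin. }
  apply (G (fun i => w (s - i)%nat)).
Qed.

Lemma is_series_cfp_smul (u : nat -> ser) (v w : ser) m :
  (forall h, is_series (fun n => u n h) (v h)) ->
  is_series (fun n => cfp m (u n * w)%ser) (cfp m (v * w)%ser).
Proof.
  intro H. destruct m as [|m]; simpl; [|now apply is_series_smul].
  specialize (H 0%nat). pose proof (is_series_lin _ _ _ _ 0 0 H H) as H0.
  replace (0 * v 0%nat + 0 * v 0%nat) with 0 in H0 by ring.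
  eapply is_series_ext; [|exact H0]. intro n. eqR. simpl. ring.
Qed.

(** A residue is a finite combination of Taylor coefficients at its node, so [jet_series] may be
    summed under it. At the node 0 the square root is 1. *)
Lemma res_series a1 a2 x k m0 m1 m2 :
  nodes_ok a1 a2 -> 0 < x -> (a2 + 1) * x <= 1/4 ->
  is_series (fun n => bin (INR k + 1/2) n * x ^ n * hres a1 a2 m0 m1 m2 n)
    (res a1 a2 m0 m1 m2 (gser 0 x k) (scst (sqrt (1 + a1 * x)) * gser a1 x k)%ser
         (scst (sqrt (1 + a2 * x)) * gser a2 x k)%ser).
Proof.
  intros Hn Hx Hax. set (c := fun n => bin (INR k + 1/2) n * x ^ n).
  apply (is_series_ext (fun n => 1 * (1 *
      cfp m0 ((scst (c n) * svar ^ n) * (sinv (- a1) ^ m1 * sinv (- a2) ^ m2))%ser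
      + 1 * cfp m1 ((scst (c n) * node a1 ^ n) * (sinv a1 ^ m0 * sinv (a1 - a2) ^ m2))%ser)
      + 1 * cfp m2 ((scst (c n) * node a2 ^ n) * (sinv a2 ^ m0 * sinv (a2 - a1) ^ m1))%ser)).
  { intro n. eqR. change (bin (INR k + 1/2) n * x ^ n) with (c n). unfold hres.
    rewrite <- res_scal. unfold res. ring. }
  unfold res.
  match goal with |- is_series _ (?A + ?B + ?C) =>
    replace (A + B + C) with (1 * (1 * A + 1 * B) + 1 * C) by ring end.
  assert (Hj : forall a, 0 <= a -> (a + 1) * x <= 1/4 ->
    forall h, is_series (fun n => (scst (c n) * node a ^ n)%ser h)
       ((scst (sqrt (1 + a * x)) * gser a x k)%ser h)).
  { intros a Ha Hb h. rewrite smul_scst.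
    apply (is_series_ext (fun n => bin (INR k + 1/2) n * x ^ n * (node a ^ n)%ser h));
      [|now apply jet_series].
    intro n. now rewrite smul_scst. }
  assert (Hmon : forall a, a <= a2 -> (a + 1) * x <= 1/4).
  { intros a Ha. apply Rle_trans with ((a2 + 1) * x); [|assumption].
    apply Rmult_le_compat_r; lra. }
  assert (Hmon0 := Hmon 0). assert (Hmon1 := Hmon a1). assert (Hmon2 := Hmon a2).
  apply is_series_lin; [apply is_series_lin|]; apply is_series_cfp_smul.
  - intro h. replace (gser 0 x k) with (scst (sqrt (1 + 0 * x)) * gser 0 x k)%ser.
    + rewrite <- node_0. apply Hj; [lra|apply Hmon0; nodes_lra].
    + rewrite Rmult_0_l, Rplus_0_r, sqrt_1. ring.
  - apply Hj; [nodes_lra|apply Hmon1; nodes_lra].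
  - apply Hj; [nodes_lra|apply Hmon2; nodes_lra].
Qed.

Lemma is_series_Rabs_le (a : nat -> R) l B :
  is_series a l -> (forall M, sum_f_R0 (fun n => Rabs (a n)) M <= B) -> Rabs l <= B.
Proof.
  intros H HB. assert (Hl : is_lim_seq (fun M => Rabs (sum_n a M)) (Rabs l))
    by now apply (is_lim_seq_abs _ l).
  apply (is_lim_seq_le _ (fun _ => B) (Rabs l) B) in Hl; [exact Hl| |apply is_lim_seq_const].
  intro M. rewrite sum_n_Reals. eapply Rle_trans; [apply Rsum_abs|apply HB].
Qed.

(** The terms with n < 3k vanish, and from n = 3k on the binomial coefficients decrease in absolute
    value. The one at 3k therefore factors out of the sum estimated in [hres_sum_bound]. *)
Lemma res_bound a1 a2 x k m0 m1 m2 :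
  nodes_ok a1 a2 -> 0 < x -> (a2 + 1) * x <= 1/4 -> (1 <= k)%nat ->
  (m0 + m1 + m2 = 3 * k + 1)%nat ->
  Rabs (res a1 a2 m0 m1 m2 (gser 0 x k) (scst (sqrt (1 + a1 * x)) * gser a1 x k)%ser
         (scst (sqrt (1 + a2 * x)) * gser a2 x k)%ser)
  <= 27 / 64 * (4 / 27) ^ k * (x ^ (3 * k) / (1 - a2 * x) ^ (3 * k + 1)).
Proof.
  intros Hn Hx Hax Hk Hm.
  eapply is_series_Rabs_le; [now apply res_series|]. intro M.
  set (b := Rabs (bin (INR k + 1/2) (3 * k))).
  apply Rle_trans with (b * sum_f_R0 (fun n => Rabs (hres a1 a2 m0 m1 m2 n) * x ^ n) M).
  - rewrite scal_sum. apply sum_Rle. intros n _.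
    rewrite !Rabs_mult, (Rabs_pos_eq (x ^ n)) by (apply pow_le; lra).
    destruct (Nat.lt_ge_cases n (3 * k)) as [Hlt|Hge].
    + rewrite hres_vanish by (assumption || lia). rewrite Rabs_R0. lra.
    + rewrite (Rmult_comm _ b), Rmult_assoc, (Rmult_comm (x ^ n)).
      apply Rmult_le_compat_r.
      * apply Rmult_le_pos; [apply Rabs_pos|apply pow_le; lra].
      * apply bin_decr; [pose proof (pos_INR k); lra| |assumption].
        rewrite mult_INR. simpl (INR 3). pose proof (pos_INR k). lra.
  - apply Rmult_le_compat; [apply Rabs_pos| |now apply bin_3k|].
    + apply cond_pos_sum. intro n. apply Rmult_le_pos; [apply Rabs_pos|apply pow_le; lra].
    + eapply Rle_trans; [apply hres_sum_bound; try assumption; try lia; nodes_lra|].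
      rewrite Hm. replace (3 * k + 1 - 1)%nat with (3 * k)%nat by lia. lra.
Qed.

(** * Independence of the three linear forms *)

Lemma cfp_euler k a : cfp (S k) (seuler a - scst (INR k) * a)%ser = 0.
Proof. simpl. unfold ssub. rewrite smul_scst. unfold seuler. ring. Qed.

(* The residue of a derivative vanishes; with A the product of the z - a_l and A' its derivative,
   this is applied to (1 + x z) z^n G / A^k. *)
Lemma local_relation a x al k n d1 d2 (G B A' : ser) : d1 <> 0 -> d2 <> 0 ->
  ((scst (1 + a * x) + scst x * svar) * seuler G = scst (al * x) * svar * G)%ser ->
  (svar * node d1 * node d2 = node a * B)%ser ->
  (svar * (node d1 + node d2) + node d1 * node d2 = A')%ser ->
  cfp (S k) (node a ^ n * (scst (x * (1 + al)) * node a * B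
    + (scst 1 + scst x * node a) * (scst (INR n) * B - scst (INR k) * A')) * G
    * (sinv d1 ^ S k * sinv d2 ^ S k))%ser = 0.
Proof.
  intros H1 H2 HG HA HA'.
  set (E := (scst 1 + scst x * node a)%ser).
  set (U1 := sinv d1). set (U2 := sinv d2). set (z := node a) in *.
  (* With F = (1 + x z) z^n G U1^k U2^k, the derivative of F / t^k is (t F' - k F) / t^(k + 1). *)
  rewrite <- (cfp_euler k (E * z ^ n * G * (U1 ^ k * U2 ^ k))%ser). f_equal.
  assert (HEa : (scst (1 + a * x) + scst x * svar)%ser = E).
  { unfold E, z, node. rewrite scst_add, scst_mul. ring. }
  rewrite HEa in HG.
  assert (HE : seuler E = (scst x * svar)%ser).
  { unfold E, z. rewrite seuler_add, seuler_mul, !seuler_scst, seuler_node. ring. }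
  (* zp stands for z^(n - 1); at n = 0 it is set to 0, harmless since it only occurs with the factor
     n. *)
  assert (Hz : exists zp, (seuler (z ^ n) = scst (INR n) * svar * zp)%ser /\
                (scst (INR n) * zp * z = scst (INR n) * z ^ n)%ser).
  { destruct n as [|n].
    - exists (scst 0). simpl. rewrite seuler_scst. split; ring.
    - exists (z ^ n)%ser. simpl spow. split; [|ring].
      rewrite seuler_mul, seuler_pow. unfold z. rewrite seuler_node, S_INR, scst_add. ring. }
  destruct Hz as (zp & Hz1 & Hz2).
  assert (V1 : (node d1 * U1 = scst 1)%ser) by now apply sinv_spec.
  assert (V2 : (node d2 * U2 = scst 1)%ser) by now apply sinv_spec.
  assert (K : scst (- INR k) = (scst 0 - scst (INR k))%ser)
    by (rewrite <- scst_sub; f_equal; ring).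
  unfold U1, U2. rewrite !seuler_mul, !seuler_sinv_pow, HE, Hz1, K by assumption. simpl spow.
  fold U1 U2. set (P := (U1 ^ k * U2 ^ k)%ser).
  set (kk := scst (INR k)). set (nn := scst (INR n)) in *.
  transitivity (P * (((scst x * svar * z ^ n + E * (nn * svar * zp)) * G
      + z ^ n * (E * seuler G)) * ((node d1 * U1) * (node d2 * U2))
     - kk * svar * E * z ^ n * G * (U1 * (node d2 * U2) + U2 * (node d1 * U1))
     - kk * E * z ^ n * G * ((node d1 * U1) * (node d2 * U2))))%ser.
  2:{ rewrite V1, V2. unfold P. ring. }
  rewrite HG, <- HA', !Rmult_plus_distr_l, !scst_add, Rmult_1_r, (Rmult_comm x al), scst_mul.
  fold P.
  transitivity (P * U1 * U2 * (((scst x + scst al * scst x) * z ^ n) * (z * B) * G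
    + E * (nn * z ^ n) * B * G
    - kk * E * z ^ n * (svar * (node d1 + node d2) + node d1 * node d2) * G))%ser;
    [unfold P; ring|].
  rewrite <- Hz2.
  transitivity (P * U1 * U2 * (((scst x + scst al * scst x) * z ^ n) * (z * B) * G
    + E * (nn * zp) * (z * B) * G
    - kk * E * z ^ n * (svar * (node d1 + node d2) + node d1 * node d2) * G))%ser;
    [ring|].
  rewrite <- HA. ring.
Qed.

Definition mres (a1 a2 : R) (m0 m1 m2 : nat) (f0 f1 f2 : ser) (n : nat) : R :=
  res a1 a2 m0 m1 m2 (svar ^ n * f0)%ser (node a1 ^ n * f1)%ser (node a2 ^ n * f2)%ser.

Lemma mres_S0 a1 a2 m0 m1 m2 f0 f1 f2 n : nodes_ok a1 a2 ->
  mres a1 a2 (S m0) m1 m2 f0 f1 f2 (S n) = mres a1 a2 m0 m1 m2 f0 f1 f2 n.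
Proof.
  intro H. unfold mres. simpl spow. rewrite <- !smul_assoc. now apply res_shift0.
Qed.

Lemma mres_S1 a1 a2 m0 m1 m2 f0 f1 f2 n : nodes_ok a1 a2 ->
  mres a1 a2 m0 (S m1) m2 f0 f1 f2 (S n)
  = mres a1 a2 m0 m1 m2 f0 f1 f2 n + a1 * mres a1 a2 m0 (S m1) m2 f0 f1 f2 n.
Proof.
  intro H. unfold mres. simpl spow. rewrite <- !smul_assoc. now apply res_mul_z1.
Qed.

Lemma mres_S2 a1 a2 m0 m1 m2 f0 f1 f2 n : nodes_ok a1 a2 ->
  mres a1 a2 m0 m1 (S m2) f0 f1 f2 (S n)
  = mres a1 a2 m0 m1 m2 f0 f1 f2 n + a2 * mres a1 a2 m0 m1 (S m2) f0 f1 f2 n.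
Proof.
  intro H. unfold mres. simpl spow. rewrite <- !smul_assoc. now apply res_mul_z2.
Qed.

Lemma mres_0 a1 a2 m0 m1 m2 f0 f1 f2 :
  mres a1 a2 m0 m1 m2 f0 f1 f2 0 = res a1 a2 m0 m1 m2 f0 f1 f2.
Proof. unfold mres. simpl spow. f_equal; ring. Qed.

(** Sums [local_relation] over the three nodes and sorts by powers of z. The lower coefficients stay
    existential, since the recurrence is solved for its leading term. *)
Lemma mres_rec a1 a2 x al k n (G0 G1 G2 : ser) : nodes_ok a1 a2 ->
  ((scst (1 + 0 * x) + scst x * svar) * seuler G0 = scst (al * x) * svar * G0)%ser ->
  ((scst (1 + a1 * x) + scst x * svar) * seuler G1 = scst (al * x) * svar * G1)%ser ->
  ((scst (1 + a2 * x) + scst x * svar) * seuler G2 = scst (al * x) * svar * G2)%ser ->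
  let M := mres a1 a2 (S k) (S k) (S k) G0 G1 G2 in
  exists c2 c1 c0,
    x * (1 + al + INR n - 3 * INR k) * M (S (S (S n)))
    + (c2 * M (S (S n)) + (c1 * M (S n) + c0 * M n)) = 0.
Proof.
  intros H HG0 HG1 HG2 M.
  set (p := a1 * a2). set (s := a1 + a2). set (K := INR k). set (L := INR n).
  (* The coefficients of z^2, z and 1 in x (1 + al) A + (1 + x z) (n B - k A'), where B = z^2 - s z
     + p and A = z B. *)
  exists (L * (1 - x * s) - x * (1 + al) * s - K * (3 - x * (2 * s))),
    (x * (1 + al) * p + L * (x * p - s) - K * (x * p - 2 * s)), (L * p - K * p).
  unfold M, mres. rewrite <- !res_scal, <- !res_add.
  assert (Hpoly : forall a (G : ser),
    (scst (x * (1 + al + L - 3 * K)) * (node a ^ S (S (S n)) * G)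
     + (scst (L * (1 - x * s) - x * (1 + al) * s - K * (3 - x * (2 * s))) * (node a ^ S (S n) * G)
     + (scst (x * (1 + al) * p + L * (x * p - s) - K * (x * p - 2 * s)) * (node a ^ S n * G)
     + scst (L * p - K * p) * (node a ^ n * G)))
    = node a ^ n * (scst (x * (1 + al)) * node a * (node a * node a - scst s * node a + scst p)
      + (scst 1 + scst x * node a) * (scst L * (node a * node a - scst s * node a + scst p)
        - scst K * (scst 3 * node a * node a - scst 2 * scst s * node a + scst p))) * G)%ser).
  { intros a G. simpl spow.
    repeat (rewrite scst_add || rewrite scst_sub || rewrite scst_mul). ring. }
  rewrite <- node_0 at 1 2 3 4. rewrite !Hpoly. unfold res.
  replace (scst 3) with (scst 1 + scst 1 + scst 1)%ser
    by (rewrite <- !scst_add; f_equal; ring).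
  replace (scst 2) with (scst 1 + scst 1)%ser by (rewrite <- !scst_add; f_equal; ring).
  unfold s, p.
  assert (N0 : forall b, scst (- b) = (scst 0 - scst b)%ser)
    by (intro b; rewrite <- scst_sub; f_equal; ring).
  rewrite (local_relation 0 x al k n (- a1) (- a2)), (local_relation a1 x al k n a1 (a1 - a2)),
    (local_relation a2 x al k n a2 (a2 - a1)); try assumption; try nodes_lra;
    unfold node; rewrite ?scst_sub, ?scst_add, ?scst_mul, ?N0; ring.
Qed.

(** Scaling the expansions by independent weights y0, y1, y2 preserves the differential equation at
    each node, so the moments still satisfy [mres_rec]. If the three forms vanish, so do all
    moments, and lowering the pole orders to a simple pole at 0 isolates y0. *)
Lemma form_nonzero a1 a2 x k y0 y1 y2 : nodes_ok a1 a2 -> 0 < x -> (1 <= k)%nat ->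
  let form m0 m1 m2 := res a1 a2 m0 m1 m2
     (scst y0 * gser 0 x k)%ser (scst y1 * gser a1 x k)%ser (scst y2 * gser a2 x k)%ser in
  form (S k) k k = 0 -> form k (S k) k = 0 -> form k k (S k) = 0 -> y0 = 0.
Proof.
  intros H Hx Hk form F0 F1 F2.
  set (G0 := (scst y0 * gser 0 x k)%ser) in *.
  set (G1 := (scst y1 * gser a1 x k)%ser) in *.
  set (G2 := (scst y2 * gser a2 x k)%ser) in *.
  set (P m0 m1 m2 := mres a1 a2 m0 m1 m2 G0 G1 G2).
  assert (HG : forall y a, 0 <= a ->
    ((scst (1 + a * x) + scst x * svar) * seuler (scst y * gser a x k)
     = scst ((INR k + 1/2) * x) * svar * (scst y * gser a x k))%ser).
  { intros y a Ha. rewrite seuler_mul, seuler_scst.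
    transitivity (scst y * ((scst (1 + a * x) + scst x * svar) * seuler (gser a x k)))%ser;
      [ring|].
    rewrite gser_euler; [ring|]. assert (0 <= a * x) by (apply Rmult_le_pos; lra). lra. }
  assert (Hall : forall n, P (S k) (S k) (S k) n = 0).
  { assert (Hrec := fun n => mres_rec a1 a2 x (INR k + 1/2) k n G0 G1 G2 H
      (HG y0 0 ltac:(lra)) (HG y1 a1 ltac:(nodes_lra)) (HG y2 a2 ltac:(nodes_lra))).
    cbv zeta in Hrec. fold P in Hrec.
    (* Over A^(k + 1) the three forms have the extra numerators (z - a_i)(z - a_j). These span the
       polynomials of degree at most 2 as the nodes are distinct, so the moments of 1, z and z^2
       vanish. *)
    assert (Hinit : P (S k) (S k) (S k) 0%nat = 0 /\ P (S k) (S k) (S k) 1%nat = 0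
      /\ P (S k) (S k) (S k) 2%nat = 0).
    { unfold form in F0, F1, F2. rewrite <- mres_0 in F0, F1, F2.
      pose proof (mres_S2 a1 a2 (S k) k k G0 G1 G2 0 H) as E1.
      pose proof (mres_S1 a1 a2 (S k) k (S k) G0 G1 G2 1 H) as E2.
      pose proof (mres_S1 a1 a2 (S k) k (S k) G0 G1 G2 0 H) as E3.
      pose proof (mres_S2 a1 a2 k (S k) k G0 G1 G2 0 H) as E4.
      pose proof (mres_S0 a1 a2 k (S k) (S k) G0 G1 G2 1 H) as E5.
      pose proof (mres_S0 a1 a2 k (S k) (S k) G0 G1 G2 0 H) as E6.
      pose proof (mres_S1 a1 a2 k k (S k) G0 G1 G2 0 H) as E7.
      assert (Q1 : P (S k) (S k) (S k) 1%nat = 0).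
      { apply (Rmult_eq_reg_l (a2 - a1)); [|nodes_lra].
        rewrite <- E6, F1 in E4. rewrite <- E6, F2 in E7. unfold P. lra. }
      assert (Q2 : P (S k) (S k) (S k) 2%nat = 0).
      { unfold P in *. rewrite <- E6, Q1, F2 in E7. lra. }
      repeat split; [|assumption|assumption].
      apply (Rmult_eq_reg_l (a1 * a2)).
      2:{ apply Rgt_not_eq, Rmult_lt_0_compat; nodes_lra. }
      unfold P in *.
      assert (E8 : mres a1 a2 (S k) k (S k) G0 G1 G2 0
        = - (a1 * mres a1 a2 (S k) (S k) (S k) G0 G1 G2 0)) by lra.
      assert (E9 : mres a1 a2 (S k) k (S k) G0 G1 G2 1 = 0) by (rewrite Q1 in E2; lra).
      rewrite E9, E8, F0 in E1. lra. }
    assert (H3 : forall n, P (S k) (S k) (S k) n = 0 /\ P (S k) (S k) (S k) (S n) = 0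
      /\ P (S k) (S k) (S k) (S (S n)) = 0).
    { induction n as [|n (I0 & I1 & I2)]; [assumption|]. repeat split; try assumption.
      destruct (Hrec n) as (c2 & c1 & c0 & E). unfold P in *. rewrite I0, I1, I2 in E.
      apply (Rmult_eq_reg_l (x * (1 + (INR k + 1/2) + INR n - 3 * INR k))); [lra|].
      intro E0. apply Rmult_integral in E0. destruct E0 as [E0|E0]; [lra|].
      (* A zero leading factor would equate an odd and an even integer. *)
      assert (E2 : 2 * INR n + 3 = 4 * INR k) by lra.
      rewrite !INR_IZR_INZ in E2. rewrite <- !mult_IZR, <- plus_IZR in E2.
      apply eq_IZR in E2. lia. }
    intro n. apply H3. }
  (* Multiplying by z - a2 lowers the order at a2 and combines consecutive moments, so vanishing of
     all moments descends; likewise at a1 and 0. *)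
  assert (Hdown2 : forall i m0 m1 m2, (forall n, P m0 m1 (i + m2)%nat n = 0) ->
     forall n, P m0 m1 m2 n = 0).
  { induction i as [|i IH]; intros m0 m1 m2 Hi; [assumption|]. apply IH.
    intro n. pose proof (mres_S2 a1 a2 m0 m1 (i + m2) G0 G1 G2 n H) as E.
    simpl in Hi. unfold P in *. rewrite !Hi in E. lra. }
  assert (Hdown1 : forall i m0 m1 m2, (forall n, P m0 (i + m1)%nat m2 n = 0) ->
     forall n, P m0 m1 m2 n = 0).
  { induction i as [|i IH]; intros m0 m1 m2 Hi; [assumption|]. apply IH.
    intro n. pose proof (mres_S1 a1 a2 m0 (i + m1) m2 G0 G1 G2 n H) as E.
    simpl in Hi. unfold P in *. rewrite !Hi in E. lra. }
  assert (Hdown0 : forall i m0 m1 m2, (forall n, P (i + m0)%nat m1 m2 n = 0) ->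
     forall n, P m0 m1 m2 n = 0).
  { induction i as [|i IH]; intros m0 m1 m2 Hi; [assumption|]. apply IH.
    intro n. unfold P in *. rewrite <- mres_S0 by assumption. apply Hi. }
  assert (Hfin : P 1%nat 0%nat 0%nat 0%nat = 0).
  { apply (Hdown2 (S k)), (Hdown1 (S k)), (Hdown0 k). intro n.
    rewrite !Nat.add_0_r, Nat.add_1_r. apply Hall. }
  unfold P in Hfin. rewrite mres_0 in Hfin. unfold res, G0 in Hfin. simpl in Hfin.
  rewrite !smul_0, gser_0 in Hfin. simpl in Hfin.
  replace (1 + 0 * x) with 1 in Hfin by ring. rewrite pow1 in Hfin. lra.
Qed.

(** * Integrality *)

Definition isZ (r : R) : Prop := exists z : Z, r = IZR z.

Lemma isZ_IZR z : isZ (IZR z).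
Proof. now exists z. Qed.

Lemma isZ_add a b : isZ a -> isZ b -> isZ (a + b).
Proof. intros [x ->] [y ->]. exists (x + y)%Z. now rewrite plus_IZR. Qed.

Lemma isZ_mul a b : isZ a -> isZ b -> isZ (a * b).
Proof. intros [x ->] [y ->]. exists (x * y)%Z. now rewrite mult_IZR. Qed.

Lemma isZ_pow a n : isZ a -> isZ (a ^ n).
Proof.
  intro H. induction n as [|n IH]; simpl; [apply (isZ_IZR 1)|now apply isZ_mul].
Qed.

Lemma isZ_sum (f : nat -> R) n : (forall i, (i <= n)%nat -> isZ (f i)) -> isZ (sum_f_R0 f n).
Proof.
  intro H. induction n as [|n IH]; simpl; [apply H; lia|].
  apply isZ_add; [apply IH; intros; apply H; lia|apply H; lia].
Qed.

(** The series a (Q t) has integer coefficients, a condition stable under products. *)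
Definition sint (Q : R) (a : ser) : Prop := forall n, isZ (Q ^ n * a n).

Lemma sint_mul Q a b : sint Q a -> sint Q b -> sint Q (a * b)%ser.
Proof.
  intros Ha Hb n. unfold smul. rewrite scal_sum. apply isZ_sum. intros i Hi.
  replace (a i * b (n - i)%nat * Q ^ n) with ((Q ^ i * a i) * (Q ^ (n - i) * b (n - i)%nat)).
  - now apply isZ_mul.
  - replace n with (i + (n - i))%nat at 4 by lia. rewrite pow_add. ring.
Qed.

Lemma sint_scst Q c : isZ c -> sint Q (scst c).
Proof.
  intros Hc [|n]; simpl.
  - now rewrite Rmult_1_l.
  - rewrite Rmult_0_r. apply (isZ_IZR 0).
Qed.

Lemma sint_pow Q a n : sint Q a -> sint Q (a ^ n)%ser.
Proof.
  intro H. induction n as [|n IH]; simpl; [apply sint_scst, (isZ_IZR 1)|now apply sint_mul].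
Qed.

(* The coefficients beyond the first are even: solving s^2 = 1 + 4t for the n-th one needs a
   division of a multiple of 4 by 2. *)
Lemma sqrt_ser_4_even n : exists z : Z, sqrt_ser 4 (S n) = 2 * IZR z.
Proof.
  induction n as [n IH] using lt_wf_ind. destruct n as [|n].
  - exists 1%Z. unfold sqrt_ser. simpl. field.
  - set (s := sqrt_ser 4) in *.
    assert (E : (s * s)%ser (S (S n)) = 0).
    { unfold s. rewrite sqrt_ser_sqr. unfold sadd. rewrite smul_scst. simpl. ring. }
    rewrite smul_S, smul_S' in E.
    assert (H1 : s 0%nat = 1) by (unfold s, sqrt_ser; simpl; ring).
    change (stl s (S n)) with (s (S (S n))) in E. rewrite H1 in E.
    assert (H2 : exists z, smul (stl s) (stl s) n = 4 * IZR z).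
    { assert (isZ (smul (fun i => / 2 * stl s i) (fun i => / 2 * stl s i) n)) as [z Hz].
      { unfold smul. apply isZ_sum. intros i Hi. unfold stl.
        destruct (IH i) as [u Hu]; [lia|]. destruct (IH (n - i)%nat) as [v Hv]; [lia|].
        rewrite Hu, Hv. exists (u * v)%Z. rewrite mult_IZR. field. }
      exists z. rewrite <- Hz, (smul_scal (/ 2) (stl s)), (smul_comm (stl s) (fun i => _ * _)), (smul_scal (/ 2) (stl s)).
      field. }
    destruct H2 as [z Hz]. rewrite Hz in E. exists (- z)%Z. rewrite opp_IZR. lra.
Qed.

Lemma sqrt_ser_4_int n : isZ (sqrt_ser 4 n).
Proof.
  destruct n as [|n].
  - exists 1%Z. unfold sqrt_ser. simpl. ring.
  - destruct (sqrt_ser_4_even n) as [z ->]. apply isZ_mul; [apply (isZ_IZR 2)|apply isZ_IZR].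
Qed.

(** What remains after the constant factor is a series in x t / (1 + a x). For x = 4/N this is 4 t /
    (N + 4a), and the 4 makes the coefficients of the square root integral. *)
Lemma gser_scale a x k : 1 + a * x <> 0 ->
  gser a x k = (scst ((1 + a * x) ^ k)
    * ((scst 1 + scst (x / (1 + a * x)) * svar) ^ k * sqrt_ser (x / (1 + a * x))))%ser.
Proof.
  intro He. unfold gser. set (e := 1 + a * x) in *. rewrite smul_assoc. f_equal.
  assert (E : (scst e + scst x * svar = scst e * (scst 1 + scst (x / e) * svar))%ser).
  { replace x with (e * (x / e)) at 1 by (field; assumption). rewrite scst_mul. ring. }
  rewrite E, spow_smul. f_equal.
  induction k as [|k IH]; simpl; [reflexivity|]. now rewrite IH, scst_mul.
Qed.

Lemma sinv_pow_int Q d m : d <> 0 -> isZ (Q / d) -> sint Q (scst (d ^ m) * sinv d ^ m)%ser.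
Proof.
  intros Hd HQ.
  replace (scst (d ^ m) * sinv d ^ m)%ser with ((scst d * sinv d) ^ m)%ser.
  - apply sint_pow. intro n. rewrite smul_scst. unfold sinv.
    replace (Q ^ n * (d * ((-1) ^ n / d ^ S n))) with ((-1) ^ n * (Q / d) ^ n).
    + apply isZ_mul; apply isZ_pow; [apply (isZ_IZR (-1))|assumption].
    + unfold Rdiv. rewrite Rpow_mult_distr, pow_inv. simpl. field.
      split; [now apply pow_nonzero|assumption].
  - rewrite spow_smul. f_equal.
    induction m as [|m IH]; simpl; [reflexivity|]. now rewrite IH, scst_mul.
Qed.

(** The single scaling Q = D E serves all factors: D clears the series in 4 t / D, and d1, d2 divide
    D E. The powers of N / D, d1 and d2 normalize the constant terms. *)
Lemma coef_int N a D E d1 d2 k m u v :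
  0 < N -> 0 < D -> D = N + 4 * a -> isZ D -> isZ E ->
  d1 <> 0 -> d2 <> 0 -> isZ (D * E / d1) -> isZ (D * E / d2) ->
  isZ ((D * E) ^ m * ((N / D) ^ k * d1 ^ u * d2 ^ v
    * (gser a (4 / N) k * (sinv d1 ^ u * sinv d2 ^ v))%ser m)).
Proof.
  intros HN HD0 HD HDZ HEZ Hd1 Hd2 HQ1 HQ2.
  assert (He : 1 + a * (4 / N) = D / N) by (rewrite HD; field; lra).
  rewrite gser_scale.
  2:{ rewrite He. apply Rgt_not_eq, Rdiv_lt_0_compat; assumption. }
  rewrite He. replace (4 / N / (D / N)) with (4 / D) by (field; lra).
  set (w := ((scst 1 + scst (4 / D) * svar) ^ k * sqrt_ser (4 / D))%ser).
  assert (Hw : sint (D * E) w).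
  { apply sint_mul; [apply sint_pow|].
    - intro n. unfold sadd. rewrite smul_scst. destruct n as [|[|n]]; simpl.
      + replace (1 * (1 + 4 / D * 0)) with 1 by ring. apply (isZ_IZR 1).
      + replace (D * E * 1 * (0 + 4 / D * 1)) with (4 * E) by (field; lra).
        apply isZ_mul; [apply (isZ_IZR 4)|assumption].
      + rewrite Rmult_0_r, Rplus_0_r, Rmult_0_r. apply (isZ_IZR 0).
    - intro n. unfold sqrt_ser.
      replace ((D * E) ^ n * (bin (1/2) n * (4 / D) ^ n)) with (E ^ n * sqrt_ser 4 n).
      + apply isZ_mul; [now apply isZ_pow|apply sqrt_ser_4_int].
      + unfold sqrt_ser, Rdiv. rewrite !Rpow_mult_distr, pow_inv. field.
        apply pow_nonzero. lra. }
  pose proof (sint_mul _ _ _ Hw (sint_mul _ _ _ (sinv_pow_int _ _ u Hd1 HQ1)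
     (sinv_pow_int _ _ v Hd2 HQ2)) m) as Hm.
  replace ((N / D) ^ k * d1 ^ u * d2 ^ v
    * (scst ((D / N) ^ k) * w * (sinv d1 ^ u * sinv d2 ^ v))%ser m) with
   ((w * (scst (d1 ^ u) * sinv d1 ^ u * (scst (d2 ^ v) * sinv d2 ^ v)))%ser m); [exact Hm|].
  replace (w * (scst (d1 ^ u) * sinv d1 ^ u * (scst (d2 ^ v) * sinv d2 ^ v)))%ser
    with (scst (d1 ^ u) * (scst (d2 ^ v) * (w * (sinv d1 ^ u * sinv d2 ^ v))))%ser by ring.
  rewrite <- (smul_assoc (scst ((D / N) ^ k)) w), !smul_scst.
  assert (E1 : (N / D) ^ k * (D / N) ^ k = 1).
  { rewrite <- Rpow_mult_distr. replace (N / D * (D / N)) with 1 by (field; lra). apply pow1. }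
  match goal with |- ?A * (?B * ?X) = _ =>
    transitivity ((N / D) ^ k * (D / N) ^ k * (A * (B * X))); [rewrite E1|]; ring end.
Qed.

(* Pole orders (k, k, k) plus one at a single node, seen from a node of order [m]. *)
Definition orders (k m u v : nat) : Prop :=
  (m = S k /\ u = k /\ v = k) \/ (m = k /\ u = S k /\ v = k) \/ (m = k /\ u = k /\ v = S k).

(** For the extra pole at the node itself the coefficient has index k, and the powers of D cancel.
    With the extra pole elsewhere the index is k - 1: one factor D E is missing and one d_i is in
    excess, which costs the integer D E / d_i. *)
Lemma cfp_int N a D E d1 d2 k m u v :
  0 < N -> 0 < D -> D = N + 4 * a -> isZ D -> isZ E ->
  d1 <> 0 -> d2 <> 0 -> isZ (D / d1) -> isZ (D * E / d2) -> (1 <= k)%nat -> orders k m u v ->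
  isZ ((N * (E * d1 * d2)) ^ k
    * cfp m (gser a (4 / N) k * (sinv d1 ^ u * sinv d2 ^ v))%ser).
Proof.
  intros HN HD0 HD HDZ HEZ Hd1 Hd2 HQ1 HQ2 Hk Hor.
  assert (HQ1' : isZ (D * E / d1)).
  { replace (D * E / d1) with (D / d1 * E) by (field; assumption). now apply isZ_mul. }
  pose proof (fun m => coef_int N a D E d1 d2 k m u v HN HD0 HD HDZ HEZ Hd1 Hd2 HQ1' HQ2) as Hc.
  assert (HDk : forall n, D ^ n <> 0) by (intro n; apply pow_nonzero; lra).
  destruct Hor as [(-> & -> & ->)|[(-> & -> & ->)|(-> & -> & ->)]];
    [|destruct k as [|k]; [lia|]..]; simpl cfp.
  - specialize (Hc k). revert Hc. set (c := smul _ _ k). intro Hc.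
    replace ((N * (E * d1 * d2)) ^ k * c) with
      ((D * E) ^ k * ((N / D) ^ k * d1 ^ k * d2 ^ k * c)); [assumption|].
    unfold Rdiv. rewrite !Rpow_mult_distr, pow_inv. field. apply HDk.
  - specialize (Hc k). revert Hc. set (c := smul _ _ k). intro Hc.
    replace ((N * (E * d1 * d2)) ^ S k * c) with
      (D / d1 * E * ((D * E) ^ k * ((N / D) ^ S k * d1 ^ S (S k) * d2 ^ S k * c))).
    + apply isZ_mul; [now apply isZ_mul|assumption].
    + unfold Rdiv. rewrite !Rpow_mult_distr, pow_inv. simpl. field.
      repeat split; [apply HDk|lra|assumption].
  - specialize (Hc k). revert Hc. set (c := smul _ _ k). intro Hc.
    replace ((N * (E * d1 * d2)) ^ S k * c) with
      (D * E / d2 * ((D * E) ^ k * ((N / D) ^ S k * d1 ^ S k * d2 ^ S (S k) * c))).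
    + now apply isZ_mul.
    + unfold Rdiv. rewrite !Rpow_mult_distr, pow_inv. simpl. field.
      repeat split; [apply HDk|lra|assumption].
Qed.

(** * Size of the coefficients *)

Lemma maj_gser a x k r : 0 <= a -> 0 < x -> 0 <= r -> r * x <= 1/2 ->
  maj r (gser a x k) (2 * (1 + a * x + r * x) ^ k).
Proof.
  intros Ha Hx Hr Hrx. assert (Hax : 0 <= a * x) by (apply Rmult_le_pos; lra).
  assert (Hrx0 : 0 <= r * x) by (apply Rmult_le_pos; lra).
  unfold gser. rewrite (Rmult_comm 2). apply maj_mul; [assumption|apply maj_pow; [assumption|]|].
  - replace (1 + a * x + r * x) with (Rabs (1 + a * x) + Rabs x * r)
      by (rewrite !Rabs_pos_eq by lra; ring).
    now apply maj_linear.
  - replace 2 with (1 / (1 - 1/2)) by field. apply maj_geom; try lra.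
    intro n. unfold sqrt_ser. rewrite Rabs_mult, <- RPow_abs, Rmult_assoc, <- Rpow_mult_distr.
    assert (Hq : 0 <= Rabs (x / (1 + a * x)) * r <= 1/2).
    { split; [apply Rmult_le_pos; [apply Rabs_pos|assumption]|].
      rewrite Rabs_pos_eq by (apply Rlt_le, Rdiv_lt_0_compat; lra).
      replace (x / (1 + a * x) * r) with (r * x / (1 + a * x)) by (field; lra).
      apply Rle_div_l; lra. }
    apply Rmult_le_compat; [apply Rabs_pos|apply pow_le; lra|apply bin_half_le|].
    apply pow_incr. lra.
Qed.

(** Cauchy's estimate at radius r. With the extra pole at another node, one factor 1 / r is replaced
    by 1 / (|d_i| - r), which is no larger because 2 r <= |d_i|. *)
Lemma cfp_bound g C r d1 d2 k m u v :
  maj r g C -> 0 < r -> 2 * r <= Rabs d1 -> 2 * r <= Rabs d2 -> (1 <= k)%nat ->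
  orders k m u v ->
  Rabs (cfp m (g * (sinv d1 ^ u * sinv d2 ^ v))%ser)
  <= C * (/ (r * (Rabs d1 - r) * (Rabs d2 - r))) ^ k.
Proof.
  intros Hg Hr H1 H2 Hk Hor. pose proof (maj_pos _ _ _ Hg) as HC.
  set (e1 := Rabs d1 - r). set (e2 := Rabs d2 - r).
  assert (Hi1 : 0 < / e1) by (apply Rinv_0_lt_compat; unfold e1; lra).
  assert (Hi2 : 0 < / e2) by (apply Rinv_0_lt_compat; unfold e2; lra).
  assert (Hir : 0 < / r) by now apply Rinv_0_lt_compat.
  assert (Hl1 : / e1 <= / r) by (apply Rinv_le_contravar; unfold e1; lra).
  assert (Hl2 : / e2 <= / r) by (apply Rinv_le_contravar; unfold e2; lra).
  assert (Hm : forall n, Rabs ((g * (sinv d1 ^ u * sinv d2 ^ v))%ser n)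
     <= C * ((/ e1) ^ u * (/ e2) ^ v) * (/ r) ^ n).
  { intro n. rewrite (pow_inv r). apply Rle_div_r; [now apply pow_lt|].
    apply maj_coef; [lra|]. apply maj_mul; [lra|assumption|].
    apply maj_mul; [lra| |]; apply maj_pow; try lra; apply maj_sinv; lra. }
  rewrite !Rinv_mult, !Rpow_mult_distr.
  assert (P1 : 0 < (/ e1) ^ k) by now apply pow_lt.
  assert (P2 : 0 < (/ e2) ^ k) by now apply pow_lt.
  destruct Hor as [(-> & -> & ->)|[(-> & -> & ->)|(-> & -> & ->)]];
    [|destruct k as [|k]; [lia|]..]; simpl cfp.
  - eapply Rle_trans; [apply Hm|]. apply Req_le. ring.
  - eapply Rle_trans; [apply Hm|]. rewrite Rmult_assoc. apply Rmult_le_compat_l; [assumption|].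
    assert (P3 : 0 < (/ r) ^ k) by now apply pow_lt.
    replace ((/ e1) ^ S (S k) * (/ e2) ^ S k * (/ r) ^ k) with
      (/ e1 * ((/ r) ^ k * (/ e1) ^ S k * (/ e2) ^ S k)) by (simpl; ring).
    replace ((/ r) ^ S k * (/ e1) ^ S k * (/ e2) ^ S k) with
      (/ r * ((/ r) ^ k * (/ e1) ^ S k * (/ e2) ^ S k)) by (simpl; ring).
    apply Rmult_le_compat_r; [|assumption].
    apply Rlt_le, Rmult_lt_0_compat; [now apply Rmult_lt_0_compat|assumption].
  - eapply Rle_trans; [apply Hm|]. rewrite Rmult_assoc. apply Rmult_le_compat_l; [assumption|].
    assert (P3 : 0 < (/ r) ^ k) by now apply pow_lt.
    replace ((/ e1) ^ S k * (/ e2) ^ S (S k) * (/ r) ^ k) with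
      (/ e2 * ((/ r) ^ k * (/ e1) ^ S k * (/ e2) ^ S k)) by (simpl; ring).
    replace ((/ r) ^ S k * (/ e1) ^ S k * (/ e2) ^ S k) with
      (/ r * ((/ r) ^ k * (/ e1) ^ S k * (/ e2) ^ S k)) by (simpl; ring).
    apply Rmult_le_compat_r; [|assumption].
    apply Rlt_le, Rmult_lt_0_compat; [now apply Rmult_lt_0_compat|assumption].
Qed.

(** * The approximation inequality *)

(** Reduces the growth rate to an inequality between nodes and radius, free of N. The factor 101/100
    absorbs 1 + a x + r x, at most 1.002 for x = 4/N, and 25/10 rounds 2.500788 down. *)
Lemma cfp_size a B N A d P r d1 d2 k m u v :
  0 < A -> 0 < B -> 0 < d -> 0 < P -> 0 < N -> 1000 * (4 * B) <= N ->
  0 <= a <= B -> 0 < r <= B -> 2 * r <= Rabs d1 -> 2 * r <= Rabs d2 ->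
  101 / 100 * (A ^ 2 * d ^ 2) <= 25 / 10 * (P * (r * (Rabs d1 - r) * (Rabs d2 - r))) ->
  (1 <= k)%nat -> orders k m u v ->
  (N * (A * B * d ^ 2)) ^ k
    * Rabs (cfp m (gser a (4 / N) k * (sinv d1 ^ u * sinv d2 ^ v))%ser)
  <= 2 * (2500788 / 1000000 * / A * P * B * N) ^ k.
Proof.
  intros HA HB Hd HP HN HBN Ha Hr H1 H2 Hnum Hk Hor.
  assert (Hx : 0 < 4 / N) by (apply Rdiv_lt_0_compat; lra).
  assert (HBx : B * (4 / N) <= 1/1000).
  { replace (B * (4 / N)) with (4 * B / N) by (field; lra). apply Rle_div_l; lra. }
  assert (Hax : 0 <= a * (4 / N) <= 1/1000).
  { split; [apply Rmult_le_pos; lra|].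
    eapply Rle_trans; [apply Rmult_le_compat_r; [lra|apply Ha]|assumption]. }
  assert (Hrx : 0 <= r * (4 / N) <= 1/1000).
  { split; [apply Rmult_le_pos; lra|].
    eapply Rle_trans; [apply Rmult_le_compat_r; [lra|apply Hr]|assumption]. }
  set (T := r * (Rabs d1 - r) * (Rabs d2 - r)) in *.
  assert (HT : 0 < T) by (unfold T; repeat apply Rmult_lt_0_compat; lra).
  assert (HAd : 0 < A * B * d ^ 2).
  { apply Rmult_lt_0_compat; [now apply Rmult_lt_0_compat|now apply pow_lt]. }
  set (e := 1 + a * (4 / N) + r * (4 / N)).
  assert (He : 0 < e <= 101/100) by (unfold e; lra).
  pose proof (cfp_bound (gser a (4 / N) k) (2 * e ^ k) r d1 d2 k m u v
    (maj_gser a (4 / N) k r ltac:(lra) Hx ltac:(lra) ltac:(lra))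
    ltac:(lra) H1 H2 Hk Hor) as Hb. fold T in Hb.
  eapply Rle_trans; [apply Rmult_le_compat_l; [|exact Hb]|].
  { apply pow_le, Rlt_le, Rmult_lt_0_compat; assumption. }
  replace ((N * (A * B * d ^ 2)) ^ k * (2 * e ^ k * (/ T) ^ k)) with
    (2 * (N * (A * B * d ^ 2) * e * / T) ^ k) by (rewrite !(Rpow_mult_distr _ _ k); ring).
  apply Rmult_le_compat_l; [lra|]. apply pow_incr. split.
  { apply Rlt_le. repeat apply Rmult_lt_0_compat; try lra; try (now apply pow_lt).
    now apply Rinv_0_lt_compat. }
  apply Rle_div_l; [assumption|].
  replace (2500788 / 1000000 * / A * P * B * N * T) with
    (B * N * / A * (2500788 / 1000000 * (P * T))) by ring.
  replace (N * (A * B * d ^ 2) * e) with (B * N * / A * (e * (A ^ 2 * d ^ 2))) by (field; lra).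
  apply Rmult_le_compat_l.
  { apply Rlt_le. repeat apply Rmult_lt_0_compat; try lra. now apply Rinv_0_lt_compat. }
  assert (0 < A ^ 2 * d ^ 2) by (apply Rmult_lt_0_compat; now apply pow_lt).
  assert (0 < P * T) by now apply Rmult_lt_0_compat.
  apply Rle_trans with (101 / 100 * (A ^ 2 * d ^ 2)); [apply Rmult_le_compat_r; lra|lra].
Qed.

(** The factors 4/27 and (4/N)^3 combine with N into 256/27 over N^2. As 256/27 is below 9.5 and
    100000/4216 above 23, the powers of 1 - B x are absorbed; the last one turns 27/64 into
    43/100. *)
Lemma remainder_size A B N k m0 m1 m2 :
  nodes_ok A B -> 1 <= B -> 1000 * (4 * B) <= N -> (1 <= k)%nat ->
  (m0 + m1 + m2 = 3 * k + 1)%nat ->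
  (N * (A * B * (B - A) ^ 2)) ^ k *
  Rabs (res A B m0 m1 m2 (gser 0 (4 / N) k) (scst (sqrt (1 + A * (4 / N))) * gser A (4 / N) k)%ser
         (scst (sqrt (1 + B * (4 / N))) * gser B (4 / N) k)%ser)
  <= 43 / 100 * (/ (4216 / 100000 * / A * / B * / (B - A) ^ 2 * N ^ 2)) ^ k.
Proof.
  intros Hn HB1 HBN Hk Hm.
  assert (HA : 0 < A) by nodes_lra. assert (HB : 0 < B) by nodes_lra.
  assert (Hd : 0 < B - A) by nodes_lra. assert (HN : 0 < N) by lra.
  assert (Hx : 0 < 4 / N) by (apply Rdiv_lt_0_compat; lra).
  assert (HBx : 0 <= B * (4 / N) <= 1/1000).
  { split; [apply Rmult_le_pos; lra|].
    replace (B * (4 / N)) with (4 * B / N) by (field; lra). apply Rle_div_l; lra. }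
  assert (Hx1 : 4 / N <= 1/1000) by (apply Rle_div_l; lra).
  assert (HAd : 0 < A * B * (B - A) ^ 2).
  { apply Rmult_lt_0_compat; [now apply Rmult_lt_0_compat|now apply pow_lt]. }
  eapply Rle_trans.
  { apply Rmult_le_compat_l; [apply pow_le, Rlt_le, Rmult_lt_0_compat; assumption|].
    apply res_bound; try assumption. lra. }
  set (t := 1 - B * (4 / N)) in *. assert (Ht : 999/1000 <= t <= 1) by (unfold t; lra).
  assert (Ht3 : 99/100 <= t ^ 3).
  { apply Rle_trans with ((999/1000) ^ 3); [lra|apply pow_incr; lra]. }
  set (W := A * B * (B - A) ^ 2) in *.
  replace ((N * W) ^ k * (27 / 64 * (4 / 27) ^ k * ((4 / N) ^ (3 * k) / t ^ (3 * k + 1))))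
    with (27 / 64 * / t * (W / N ^ 2 * (256 / 27 * / t ^ 3)) ^ k).
  2:{ rewrite pow_add, !(pow_mult _ 3 k), pow_1.
      unfold Rdiv. rewrite (Rinv_mult ((t ^ 3) ^ k) t), <- (pow_inv (t ^ 3) k).
      transitivity (27 * / 64 * / t * (N * W * (4 * / 27) * (4 * / N) ^ 3 * / t ^ 3) ^ k).
      - f_equal. f_equal. field. split; lra.
      - rewrite !(Rpow_mult_distr _ _ k). ring. }
  apply Rmult_le_compat.
  - apply Rmult_le_pos; [lra|]. apply Rlt_le, Rinv_0_lt_compat. lra.
  - apply pow_le. apply Rlt_le. repeat apply Rmult_lt_0_compat; try lra; try assumption;
      apply Rinv_0_lt_compat; [apply (pow_lt N 2 HN)|lra].
  - apply Rle_div_l; lra.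
  - assert (Hw : 0 < W / N ^ 2) by (apply Rdiv_lt_0_compat; [assumption|now apply pow_lt]).
    apply pow_incr. split.
    + apply Rlt_le. apply Rmult_lt_0_compat; [assumption|].
      apply Rmult_lt_0_compat; [lra|]. apply Rinv_0_lt_compat. lra.
    + replace (/ (4216 / 100000 * / A * / B * / (B - A) ^ 2 * N ^ 2)) with
        (W / N ^ 2 * (100000 / 4216)) by (unfold W; field; repeat split; lra).
      apply Rmult_le_compat_l; [lra|]. apply Rle_div_l; lra.
Qed.

Lemma res_weights a1 a2 m0 m1 m2 y0 y1 y2 g0 g1 g2 :
  res a1 a2 m0 m1 m2 (scst y0 * g0)%ser (scst y1 * g1)%ser (scst y2 * g2)%ser
  = y0 * cfp m0 (g0 * (sinv (- a1) ^ m1 * sinv (- a2) ^ m2))%ser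
    + y1 * cfp m1 (g1 * (sinv a1 ^ m0 * sinv (a1 - a2) ^ m2))%ser
    + y2 * cfp m2 (g2 * (sinv a2 ^ m0 * sinv (a2 - a1) ^ m1))%ser.
Proof. unfold res. now rewrite <- !smul_assoc, !cfp_scal. Qed.

Lemma isZ_abs_ge1 r : isZ r -> r <> 0 -> 1 <= Rabs r.
Proof.
  intros [z ->] Hz. rewrite <- abs_IZR. apply IZR_le.
  assert (z <> 0%Z) by (intros ->; now apply Hz). lia.
Qed.

(** A form that does not vanish at (q, p2, p1) becomes a nonzero integer after clearing
    denominators, so its absolute value is at least 1. It differs from q times the small remainder
    by the two approximation errors times their coefficients. *)
Lemma approx_ineq (a1 a2 N p1 p2 q : Z) (P delta : R) (k : nat) :
  (0 < a1)%Z -> (a1 <= a2 - 2)%Z -> (0 < N)%Z -> Z.divide (a1 * a2) N -> (0 < q)%Z ->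
  4 * (IZR a2 - IZR a1) <= P -> 4 * IZR a1 <= P -> 1000 * (4 * IZR a2) <= IZR N ->
  Rabs (sqrt (1 + 4 * IZR a2 / IZR N) - IZR p1 / IZR q) <= delta ->
  Rabs (sqrt (1 + 4 * IZR a1 / IZR N) - IZR p2 / IZR q) <= delta ->
  (1 <= k)%nat ->
  1 <= 43 / 100 * IZR q
        * (/ (4216 / 100000 * / IZR a1 * / IZR a2 * / (IZR a2 - IZR a1) ^ 2 * IZR N ^ 2)) ^ k
       + 4 * (2500788 / 1000000 * / IZR a1 * P * IZR a2 * IZR N) ^ k * (IZR q * delta).
Proof.
  intros Ha1 Ha2 HN Hdiv Hq HP1 HP2 HBN Hd1 Hd2 Hk.
  set (A := IZR a1) in *. set (B := IZR a2) in *. set (M := IZR N) in *.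
  assert (HA : 1 <= A) by (apply IZR_le; lia).
  assert (HAB : A + 2 <= B) by (unfold A, B; rewrite <- plus_IZR; apply IZR_le; lia).
  assert (HM : 0 < M) by (apply IZR_lt; lia).
  assert (HQ : 0 < IZR q) by (apply IZR_lt; lia).
  assert (Hn : nodes_ok A B) by (split; lra).
  set (x := 4 / M).
  assert (Hx : 0 < x) by (apply Rdiv_lt_0_compat; lra).
  set (thA := sqrt (1 + A * x)). set (thB := sqrt (1 + B * x)).
  assert (EA : sqrt (1 + 4 * A / M) = thA)
    by (unfold thA, x; f_equal; field; lra).
  assert (EB : sqrt (1 + 4 * B / M) = thB)
    by (unfold thB, x; f_equal; field; lra).
  rewrite EA in Hd2. rewrite EB in Hd1.
  set (Delta := (M * (A * B * (B - A) ^ 2)) ^ k).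
  assert (HDelta : 0 < Delta).
  { apply pow_lt. repeat apply Rmult_lt_0_compat; lra. }
  set (form m0 m1 m2 := res A B m0 m1 m2
     (scst (IZR q) * gser 0 x k)%ser (scst (IZR p2) * gser A x k)%ser
     (scst (IZR p1) * gser B x k)%ser).
  assert (Hmain : forall m0 m1 m2, (m0 + m1 + m2 = 3 * k + 1)%nat ->
    orders k m0 m1 m2 -> orders k m1 m0 m2 -> orders k m2 m0 m1 -> form m0 m1 m2 <> 0 ->
    1 <= 43 / 100 * IZR q
        * (/ (4216 / 100000 * / A * / B * / (B - A) ^ 2 * M ^ 2)) ^ k
       + 4 * (2500788 / 1000000 * / A * P * B * M) ^ k * (IZR q * delta)).
  { intros m0 m1 m2 Hm O0 O1 O2 Hnz. unfold form in Hnz.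
    rewrite res_weights in Hnz.
    pose proof (remainder_size A B M k m0 m1 m2 Hn ltac:(lra) HBN Hk Hm) as Hrem.
    fold x thA thB Delta in Hrem.
    replace (gser 0 x k) with (scst 1 * gser 0 x k)%ser in Hrem by ring.
    rewrite res_weights in Hrem.
    destruct Hdiv as [w Hw].
    assert (EM : M = IZR w * A * B).
    { unfold M, A, B. rewrite Hw, !mult_IZR. ring. }
    assert (I0 : isZ (Delta * cfp m0 (gser 0 x k * (sinv (- A) ^ m1 * sinv (- B) ^ m2))%ser)).
    (* At the node 0 take D = N and E = 1; divisibility of N by a1 a2 makes N / a1 and N / a2
       integers. *)
    { replace Delta with (((B - A) ^ 2) ^ k * (M * (1 * - A * - B)) ^ k).
      2:{ unfold Delta. rewrite <- Rpow_mult_distr. f_equal. ring. }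
      rewrite Rmult_assoc. apply isZ_mul.
      - apply isZ_pow, isZ_pow. unfold A, B. rewrite <- minus_IZR. apply isZ_IZR.
      - apply (cfp_int M 0 M 1 (- A) (- B) k); try assumption; try lra.
        + apply isZ_IZR.
        + apply (isZ_IZR 1).
        + exists (- w * a2)%Z. rewrite mult_IZR, opp_IZR, EM. fold B. field. lra.
        + exists (- w * a1)%Z. rewrite mult_IZR, opp_IZR, EM. fold A. field. lra. }
    (* At a1 take D = N + 4 a1, divisible by a1, and E = a1 - a2, which cancels the other node
       distance. The node a2 below is symmetric. *)
    assert (I1 : isZ (Delta * cfp m1 (gser A x k * (sinv A ^ m0 * sinv (A - B) ^ m2))%ser)).
    { replace Delta with (B ^ k * (M * ((A - B) * A * (A - B))) ^ k).
      2:{ unfold Delta. rewrite <- Rpow_mult_distr. f_equal. ring. }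
      rewrite Rmult_assoc. apply isZ_mul; [apply isZ_pow, isZ_IZR|].
      apply (cfp_int M A (M + 4 * A) (A - B) A (A - B) k); try assumption; try lra.
      - exists (N + 4 * a1)%Z. rewrite plus_IZR, mult_IZR. reflexivity.
      - exists (a1 - a2)%Z. now rewrite minus_IZR.
      - exists (w * a2 + 4)%Z. rewrite plus_IZR, mult_IZR, EM. fold B. field. lra.
      - exists (N + 4 * a1)%Z. rewrite plus_IZR, mult_IZR. fold A M. field. lra. }
    assert (I2 : isZ (Delta * cfp m2 (gser B x k * (sinv B ^ m0 * sinv (B - A) ^ m1))%ser)).
    { replace Delta with (A ^ k * (M * ((B - A) * B * (B - A))) ^ k).
      2:{ unfold Delta. rewrite <- Rpow_mult_distr. f_equal. ring. }
      rewrite Rmult_assoc. apply isZ_mul; [apply isZ_pow, isZ_IZR|].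
      apply (cfp_int M B (M + 4 * B) (B - A) B (B - A) k); try assumption; try lra.
      - exists (N + 4 * a2)%Z. rewrite plus_IZR, mult_IZR. reflexivity.
      - exists (a2 - a1)%Z. now rewrite minus_IZR.
      - exists (w * a1 + 4)%Z. rewrite plus_IZR, mult_IZR, EM. fold A. field. lra.
      - exists (N + 4 * a2)%Z. rewrite plus_IZR, mult_IZR. fold B M. field. lra. }
    assert (S2 : Delta * Rabs (cfp m2 (gser B x k * (sinv B ^ m0 * sinv (B - A) ^ m1))%ser)
       <= 2 * (2500788 / 1000000 * / A * P * B * M) ^ k).
    (* The radius is half the distance to the nearest node a1, and P >= 4 a1 suffices. *)
    { apply (cfp_size B B M A (B - A) P ((B - A) / 2)); try lra; try assumption;
        rewrite ?(Rabs_pos_eq B), ?(Rabs_pos_eq (B - A)) by lra; try lra.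
      set (d := B - A) in *. replace B with (A + d) by (unfold d; ring).
      assert (0 <= A ^ 2 * d ^ 2) by (apply Rmult_le_pos; apply pow2_ge_0).
      assert (0 <= d ^ 2 * (A + d / 2)) by (apply Rmult_le_pos; [apply pow2_ge_0|unfold d; lra]).
      assert (0 <= A * d ^ 2 * d)
        by (apply Rmult_le_pos; [apply Rmult_le_pos; [lra|apply pow2_ge_0]|unfold d; lra]).
      replace (d / 2 * (A + d - d / 2) * (d - d / 2)) with (d ^ 2 * (A + d / 2) / 4) by field.
      apply (Rmult_le_compat_r (d ^ 2 * (A + d / 2))) in HP2; lra. }
    assert (S1 : Delta * Rabs (cfp m1 (gser A x k * (sinv A ^ m0 * sinv (A - B) ^ m2))%ser)
       <= 2 * (2500788 / 1000000 * / A * P * B * M) ^ k).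
    { assert (Hd : Rabs (A - B) = B - A) by (rewrite Rabs_left; lra).
      set (d := B - A) in *.
      assert (Hd0 : 0 < d) by (unfold d; lra).
      assert (Hsq : 0 <= A ^ 2 * d ^ 2) by (apply Rmult_le_pos; apply pow2_ge_0).
      (* The nearest node to a1 is 0 or a2, and the radius is half that distance. The first case
         uses P >= 4 (a2 - a1), the second P >= 4 a1, hence the maximum in [a1prime]; each leaves
         2.5 / 2 against 1.01. *)
      destruct (Rle_lt_dec A d) as [Hc|Hc].
      - apply (cfp_size A B M A d P (A / 2)); try lra; try assumption;
          rewrite ?Hd, ?(Rabs_pos_eq A) by lra; try lra.
        replace (A / 2 * (A - A / 2) * (d - A / 2)) with (A ^ 2 / 4 * (d - A / 2)) by field.
        assert (H1 : A ^ 2 / 4 * (d / 2) <= A ^ 2 / 4 * (d - A / 2))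
          by (apply Rmult_le_compat_l; [pose proof (pow2_ge_0 A); lra|lra]).
        assert (H0 : 0 <= A ^ 2 / 4 * (d / 2))
          by (apply Rmult_le_pos; [pose proof (pow2_ge_0 A); lra|lra]).
        assert (H2 : 4 * d * (A ^ 2 / 4 * (d / 2)) <= P * (A ^ 2 / 4 * (d - A / 2)))
          by (apply Rmult_le_compat; lra).
        lra.
      - apply (cfp_size A B M A d P (d / 2)); try lra; try assumption;
          rewrite ?Hd, ?(Rabs_pos_eq A) by lra; try (unfold d in *; lra).
        replace (d / 2 * (A - d / 2) * (d - d / 2)) with (d ^ 2 / 4 * (A - d / 2)) by field.
        assert (H1 : d ^ 2 / 4 * (A / 2) <= d ^ 2 / 4 * (A - d / 2))
          by (apply Rmult_le_compat_l; [pose proof (pow2_ge_0 d); lra|lra]).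
        assert (H0 : 0 <= d ^ 2 / 4 * (A / 2))
          by (apply Rmult_le_pos; [pose proof (pow2_ge_0 d); lra|lra]).
        assert (H2 : 4 * A * (d ^ 2 / 4 * (A / 2)) <= P * (d ^ 2 / 4 * (A - d / 2)))
          by (apply Rmult_le_compat; lra).
        lra. }
    set (c0 := cfp m0 _) in *. set (c1 := cfp m1 _) in *. set (c2 := cfp m2 _) in *.
    set (Pk := (2500788 / 1000000 * / A * P * B * M) ^ k) in *.
    set (Lk := (/ (4216 / 100000 * / A * / B * / (B - A) ^ 2 * M ^ 2)) ^ k) in *.
    assert (Hint : 1 <= Rabs (Delta * (IZR q * c0 + IZR p2 * c1 + IZR p1 * c2))).
    { apply isZ_abs_ge1.
      - replace (Delta * (IZR q * c0 + IZR p2 * c1 + IZR p1 * c2)) with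
          (IZR q * (Delta * c0) + IZR p2 * (Delta * c1) + IZR p1 * (Delta * c2)) by ring.
        repeat apply isZ_add; apply isZ_mul; try apply isZ_IZR; assumption.
      - intro E. apply Rmult_integral in E. destruct E as [E|E]; [lra|now apply Hnz]. }
    (* Replaces p2 / q and p1 / q by the square roots, at the price of the two errors. *)
    replace (Delta * (IZR q * c0 + IZR p2 * c1 + IZR p1 * c2)) with
      (IZR q * (Delta * (1 * c0 + thA * c1 + thB * c2))
       + (- (IZR q * (thA - IZR p2 / IZR q) * (Delta * c1))
          + - (IZR q * (thB - IZR p1 / IZR q) * (Delta * c2)))) in Hint
      by (field; lra).
    assert (Hterm : forall u v, Rabs u <= delta -> Delta * Rabs v <= 2 * Pk ->
       Rabs (- (IZR q * u * (Delta * v))) <= 2 * Pk * (IZR q * delta)).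
    { intros u v Hu Hv. rewrite Rabs_Ropp, !Rabs_mult, (Rabs_pos_eq (IZR q)), (Rabs_pos_eq Delta)
        by lra.
      rewrite (Rmult_comm (2 * Pk)). apply Rmult_le_compat.
      - apply Rmult_le_pos; [lra|apply Rabs_pos].
      - apply Rmult_le_pos; [lra|apply Rabs_pos].
      - apply Rmult_le_compat_l; lra.
      - assumption. }
    pose proof (Hterm _ _ Hd2 S1) as T1. pose proof (Hterm _ _ Hd1 S2) as T2.
    assert (T0 : Rabs (IZR q * (Delta * (1 * c0 + thA * c1 + thB * c2)))
       <= IZR q * (43 / 100 * Lk)).
    { rewrite !Rabs_mult, (Rabs_pos_eq (IZR q)), (Rabs_pos_eq Delta) by lra.
      apply Rmult_le_compat_l; [lra|assumption]. }
    eapply Rle_trans; [exact Hint|]. eapply Rle_trans; [apply Rabs_triang|].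
    eapply Rle_trans; [apply Rplus_le_compat_l, Rabs_triang|]. lra. }
  destruct (Req_dec (form (S k) k k) 0) as [F0|F0].
  2:{ apply (Hmain (S k) k k); [lia|unfold orders; tauto..|assumption]. }
  destruct (Req_dec (form k (S k) k) 0) as [F1|F1].
  2:{ apply (Hmain k (S k) k); [lia|unfold orders; tauto..|assumption]. }
  destruct (Req_dec (form k k (S k)) 0) as [F2|F2].
  2:{ apply (Hmain k k (S k)); [lia|unfold orders; tauto..|assumption]. }
  pose proof (form_nonzero A B x k (IZR q) (IZR p2) (IZR p1) Hn Hx Hk F0 F1 F2). lra.
Qed.

(** * From the approximation inequality to the exponent *)

Lemma power_between L q : 1 < L -> 1 <= q ->
  exists k, q <= L ^ S k /\ L ^ k <= q.
Proof.
  intros HL Hq.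
  assert (Hex : exists n, q <= L ^ S n).
  { destruct (Pow_x_infinity L) with (b := q) as [n Hn]; [rewrite Rabs_pos_eq; lra|].
    exists n. specialize (Hn (S n) ltac:(lia)).
    rewrite Rabs_pos_eq in Hn by (apply pow_le; lra). lra. }
  (* Descends from a large exponent to the least one that still works. *)
  destruct Hex as [n Hn]. induction n as [|n IH].
  - exists 0%nat. split; [assumption|simpl; lra].
  - destruct (Rle_lt_dec q (L ^ S n)) as [H|H]; [now apply IH|].
    exists (S n). split; [assumption|lra].
Qed.

Theorem mainTheorem6 (a1 a2 N : Z) :
  (0 < a1)%Z -> (a1 <= a2 - 2)%Z -> (3 <= a2)%Z ->
  (0 < N)%Z -> Z.divide (a1 * a2) N ->
  39659 / 100 * IZR (a1prime a1 a2) * (IZR a2) ^ 2 * (IZR (a2 - a1)) ^ 2 <= IZR N ->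
  lam a1 a2 N < 2 /\
  forall p1 p2 q : Z, (0 < q)%Z ->
    Rmax (Rabs (sqrt (1 + 4 * IZR a2 / IZR N) - IZR p1 / IZR q))
         (Rabs (sqrt (1 + 4 * IZR a1 / IZR N) - IZR p2 / IZR q))
    > IZR a1 / (353081 * 10 ^ 22 * IZR (a1prime a1 a2) * IZR a2 * IZR N)
      * Rpower (IZR q) (- lam a1 a2 N).
Proof.
  intros Ha1 Ha2 Ha23 HN Hdiv Hbig. unfold lam.
  set (P := IZR (a1prime a1 a2)) in *.
  assert (HP1 : 4 * (IZR a2 - IZR a1) <= P).
  { unfold P, a1prime. rewrite <- minus_IZR, <- mult_IZR. apply IZR_le. lia. }
  assert (HP2 : 4 * IZR a1 <= P).
  { unfold P, a1prime. rewrite <- mult_IZR. apply IZR_le. lia. }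
  rewrite minus_IZR in *.
  assert (HA : 1 <= IZR a1) by (apply IZR_le; lia).
  assert (HAB : IZR a1 + 2 <= IZR a2) by (rewrite <- plus_IZR; apply IZR_le; lia).
  assert (HM : 0 < IZR N) by (apply IZR_lt; lia).
  (* With a2 - a1 >= 2, P >= 8 and a2 >= 3, the hypothesis gives N >= 396.59 * 96 * a2, well above
     4000 a2. *)
  assert (Hd4 : 4 <= (IZR a2 - IZR a1) ^ 2) by nra.
  assert (HB9 : 3 * IZR a2 <= IZR a2 ^ 2) by nra.
  assert (HPB : 8 * (3 * IZR a2) <= P * IZR a2 ^ 2) by (apply Rmult_le_compat; lra).
  assert (HPBd : 8 * (3 * IZR a2) * 4 <= P * IZR a2 ^ 2 * (IZR a2 - IZR a1) ^ 2)
    by (apply Rmult_le_compat; lra).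
  assert (HBN : 1000 * (4 * IZR a2) <= IZR N) by lra.
  set (PP := 2500788 / 1000000 * / IZR a1 * P * IZR a2 * IZR N).
  set (L := 4216 / 100000 * / IZR a1 * / IZR a2 * / (IZR a2 - IZR a1) ^ 2 * IZR N ^ 2).
  assert (HPP : 1 < PP).
  { assert (E : PP = 2500788 / 1000000 * P * IZR N * (IZR a2 / IZR a1))
      by (unfold PP; field; lra).
    assert (1 <= IZR a2 / IZR a1) by (apply Rle_div_r; lra).
    assert (8 * 1 <= P * IZR N) by (apply Rmult_le_compat; lra).
    rewrite E. nra. }
  (* After the common factor this reads 2.500788 P a2^2 (a2 - a1)^2 < 0.04216 N, and 0.04216 *
     396.59 exceeds 16. *)
  assert (HPL : PP < L).
  { assert (Hc : 0 < / IZR a1 * / IZR a2 * / (IZR a2 - IZR a1) ^ 2 * IZR N).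
    { repeat apply Rmult_lt_0_compat; try lra; apply Rinv_0_lt_compat; lra. }
    assert (E1 : PP = / IZR a1 * / IZR a2 * / (IZR a2 - IZR a1) ^ 2 * IZR N *
      (2500788 / 1000000 * (P * IZR a2 ^ 2 * (IZR a2 - IZR a1) ^ 2)))
      by (unfold PP; field; lra).
    assert (E2 : L = / IZR a1 * / IZR a2 * / (IZR a2 - IZR a1) ^ 2 * IZR N *
      (4216 / 100000 * IZR N)) by (unfold L; field; lra).
    rewrite E1, E2. apply Rmult_lt_compat_l; [assumption|]. lra. }
  assert (HlnL : 0 < ln L) by (rewrite <- ln_1; apply ln_increasing; lra).
  assert (HlnP : 0 < ln PP) by (rewrite <- ln_1; apply ln_increasing; lra).
  assert (HlnPL : ln PP < ln L) by (apply ln_increasing; lra).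
  set (mu := ln PP / ln L).
  assert (Hmu : 0 < mu) by (apply Rdiv_lt_0_compat; assumption).
  split.
  { assert (mu < 1) by (apply Rlt_div_l; lra). lra. }
  intros p1 p2 q Hq.
  match goal with |- Rmax ?X ?Y > _ => set (delta := Rmax X Y) end.
  assert (Hd1 : Rabs (sqrt (1 + 4 * IZR a2 / IZR N) - IZR p1 / IZR q) <= delta)
    by apply Rmax_l.
  assert (Hd2 : Rabs (sqrt (1 + 4 * IZR a1 / IZR N) - IZR p2 / IZR q) <= delta)
    by apply Rmax_r.
  assert (HQ : 1 <= IZR q) by (apply IZR_le; lia).
  (* The inequality is used at k + 1: q <= L^(k + 1) bounds the remainder term by 43/100, while L^k
     <= q keeps PP^k below q^mu. *)
  destruct (power_between L (IZR q)) as (k & Hk1 & Hk2); [lra|assumption|].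
  pose proof (approx_ineq a1 a2 N p1 p2 q P delta (S k) Ha1 Ha2 HN Hdiv Hq HP1 HP2 HBN Hd1 Hd2
    ltac:(lia)) as Hmain.
  fold PP L in Hmain.
  assert (Hfirst : IZR q * (/ L) ^ S k <= 1).
  { rewrite pow_inv. apply Rle_div_l; [apply pow_lt; lra|lra]. }
  assert (Hdelta : 0 <= delta)
    by (eapply Rle_trans; [apply Rabs_pos|exact Hd1]).
  assert (Hpow : PP ^ k <= Rpower (IZR q) mu).
  { assert (E : PP ^ k = Rpower (L ^ k) mu).
    { rewrite <- !Rpower_pow by lra. rewrite Rpower_mult. unfold Rpower, mu.
      f_equal. field. lra. }
    rewrite E. apply Rle_Rpower_l; [lra|]. split; [apply pow_lt; lra|assumption]. }
  set (qm := Rpower (IZR q) mu) in *.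
  assert (Hqm : 0 < qm) by apply exp_pos.
  assert (Einv : Rpower (IZR q) (- (1 + mu)) = / (IZR q * qm)).
  { rewrite Rpower_Ropp, Rpower_plus, Rpower_1 by lra. reflexivity. }
  rewrite Einv.
  (* 57/100 is 1 - 43/100; of PP^(k + 1), one factor PP is kept and PP^k is bounded by q^mu. *)
  assert (Hlow : 57 / 100 <= 4 * PP * (delta * (IZR q * qm))).
  { assert (Hqd : 0 <= IZR q * delta) by (apply Rmult_le_pos; lra).
    assert (H1 : PP ^ S k * (IZR q * delta) <= PP * qm * (IZR q * delta)).
    { apply Rmult_le_compat_r; [assumption|]. simpl.
      apply Rmult_le_compat_l; lra. }
    lra. }
  apply Rlt_gt.
  assert (Hqq : 0 < IZR q * qm) by (apply Rmult_lt_0_compat; lra).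
  apply Rlt_div_l; [assumption|].
  set (X := delta * (IZR q * qm)) in *.
  assert (HPBN : 0 < P * IZR a2 * IZR N) by (repeat apply Rmult_lt_0_compat; lra).
  assert (Hten : 1 <= 10 ^ 22) by (apply pow_R1_Rle; lra).
  assert (EPP : PP = 2500788 / 1000000 * (P * IZR a2 * IZR N / IZR a1))
    by (unfold PP; field; lra).
  set (Y := P * IZR a2 * IZR N / IZR a1) in *.
  assert (HY : 0 < Y) by (apply Rdiv_lt_0_compat; lra).
  replace (IZR a1 / (353081 * 10 ^ 22 * P * IZR a2 * IZR N))
    with (/ (353081 * 10 ^ 22) / Y) by (unfold Y; field; repeat split; lra).
  apply Rlt_div_l; [assumption|].
  (* The quantity X Y is at least 0.57 / (4 * 2.500788), about 0.057, so even 1 / 353081 lies below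
     it. *)
  assert (/ (353081 * 10 ^ 22) <= / 353081) by (apply Rinv_le_contravar; lra).
  rewrite EPP in Hlow. lra.
Qed.
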